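(* Let $n\ge 1$, $N:=2^n$, and consider the $n$-qubit bilinear control system $\Sigma_a$ $$\dot\rho(t) = -\big(i\hat H_u(t) + \gamma(t)\,\Gamma_a\big)\rho(t),\qquad \rho(0)=\rho_0,$$ where $H_u(t)=H_0+\sum_{j=1}^m u_j(t)H_j$ with Hermitian $H_0,H_1,\dots,H_m$ on $(\mathbb C^2)^{\otimes n}$, real piecewise-constant (not necessarily bounded) control amplitudes $u_j(t)$, $\hat H(\rho):=[H,\rho]$, and $$\Gamma_a(\rho) := -\Big(V_a\rho V_a^\dagger - \tfrac12\big(V_a^\dagger V_a\rho+\rho V_a^\dagger V_a\big)\Big),\qquad V_a:=\mathbb 1_2^{\otimes(n-1)}\otimes|0\rangle\langle 1|,$$ i.e. amplitude-damping relaxation on the $n$-th qubit, whose noise amplitude is a piecewise-constant control switchable between two values, $\gamma(t)\in\{0,\gamma_*\}$ with a fixed $\gamma_*>0$. Assume there are no further sources of decoherence, and that the Hamiltonian controllability condition $$\langle iH_0, iH_1,\dots,iH_m\rangle_{\mathrm{Lie}} = \mathfrak{su}(N)$$ holds. Then for every density operator $\rho_0\in\mathfrak{pos}_1$, $$\overline{\mathfrak{reach}_{\Sigma_a}(\rho_0)} = \mathfrak{pos}_1,$$ where the closure is understood as the limit $\gamma_*\tau\to\infty$ of the total control duration $\tau$.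
   Context: $\mathfrak{pos}_1$ denotes the set of all density operators (positive semidefinite, trace one) on $(\mathbb C^2)^{\otimes n}$. $\langle\cdot\rangle_{\mathrm{Lie}}$ denotes the Lie algebra generated by the given elements (closure under linear combinations and commutators). The reachable set $\mathfrak{reach}_{\Sigma_a}(\rho_0)$ is the set of all states $\rho(\tau)$, $\tau\ge 0$, obtainable from $\rho_0$ by solutions of the control system for some admissible choice of controls $u_j(t)$ and $\gamma(t)$. Its closure consists of the states reachable asymptotically as $\gamma_*\tau\to\infty$. *)

(* Defs.v *)
From HB Require Import structures.
From mathcomp Require Import all_boot all_order all_algebra.
From mathcomp Require Import complex mxtens.
From mathcomp Require Import all_classical all_reals all_analysis.

Unset Printing Implicit Defensive.

Import Order.TTheory GRing.Theory Num.Theory.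
Local Open Scope ring_scope.
Local Open Scope complex_scope.

(* Complex numbers C := R[i] over a real type R; n = n'.+1 qubits,
   Hilbert-space dimension N = 2 ^ n. Matrices are 'M[R[i]]_(2 ^ n'.+1). *)

Definition qdim (n' : nat) : nat := (2 ^ n'.+1)%N.

Notation CM R n' := 'M[R[i]]_(qdim n').

Definition q_adj {R : rcfType} {N : nat} (A : 'M[R[i]]_N) : 'M[R[i]]_N :=
  \matrix_(i, j) (A j i)^*.

Definition q_comm {R : rcfType} {N : nat} (A B : 'M[R[i]]_N) : 'M[R[i]]_N :=
  A *m B - B *m A.

Definition q_hermitian {R : rcfType} {N : nat} (A : 'M[R[i]]_N) : Prop :=
  q_adj A = A.

Definition q_su {R : rcfType} {N : nat} (X : 'M[R[i]]_N) : Prop :=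
  q_adj X = - X /\ \tr X = 0.

Definition q_lie_closed {R : rcfType} {N : nat} (P : 'M[R[i]]_N -> Prop) : Prop :=
  [/\ P 0,
      (forall X Y, P X -> P Y -> P (X + Y)),
      (forall (r : R) X, P X -> P (r%:C *: X)) &
      (forall X Y, P X -> P Y -> P (q_comm X Y))].

Definition q_lie_gen {R : rcfType} {N : nat} (S : 'M[R[i]]_N -> Prop)
  (X : 'M[R[i]]_N) : Prop :=
  forall P : 'M[R[i]]_N -> Prop, q_lie_closed P -> (forall Y, S Y -> P Y) -> P X.

Definition q_vadj {R : rcfType} {N : nat} (v : 'cV[R[i]]_N) : 'rV[R[i]]_N :=
  \row_j (v j 0)^*.

Definition q_density {R : rcfType} {N : nat} (rho : 'M[R[i]]_N) : Prop :=
  [/\ q_hermitian rho,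
      (forall v : 'cV[R[i]]_N, 0 <= (q_vadj v *m rho *m v) 0 0) &
      \tr rho = 1].

(* The Lindblad operator V_a = 1_2^{(x)(n-1)} (x) |0><1| on n = n'.+1 qubits,
   built with the Kronecker product of mxtens (first factor most significant),
   cast from dimension 2^n' * 2 to 2^(n'.+1). *)
Lemma dim_tens (n' : nat) : (2 ^ n' * 2 = qdim n')%N.
Proof. by rewrite /qdim expnSr. Qed.

Definition q_ket0bra1 {R : rcfType} : 'M[R[i]]_2 := delta_mx 0 1.

Definition q_Va {R : rcfType} (n' : nat) : 'M[R[i]]_(qdim n') :=
  castmx (dim_tens n', dim_tens n')
    (((1%:M : 'M[R[i]]_2) ^t n') *t q_ket0bra1).

Definition q_Gamma_a {R : rcfType} (n' : nat) (rho : 'M[R[i]]_(qdim n'))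
  : 'M[R[i]]_(qdim n') :=
  let V := q_Va n' in
  - (V *m rho *m q_adj V
     - 2%:R^-1 *: (q_adj V *m V *m rho + rho *m q_adj V *m V)).

Definition q_Hu {R : rcfType} {N m : nat} (H0 : 'M[R[i]]_N)
  (H : 'I_m -> 'M[R[i]]_N) (u : 'I_m -> R) : 'M[R[i]]_N :=
  H0 + \sum_(j < m) (u j)%:C *: H j.

Definition q_generator {R : rcfType} (n' m : nat) (H0 : 'M[R[i]]_(qdim n'))
  (H : 'I_m -> 'M[R[i]]_(qdim n')) (u : 'I_m -> R) (gamma : R)
  (rho : 'M[R[i]]_(qdim n')) : 'M[R[i]]_(qdim n') :=
  - ('i *: q_comm (q_Hu H0 H u) rho + gamma%:C *: q_Gamma_a n' rho).

Definition q_flow {R : realType} {N : nat}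
  (L : 'M[R[i]]_N -> 'M[R[i]]_N) (t : R) (rho_a rho_b : 'M[R[i]]_N) : Prop :=
  exists f : R -> 'M[R[i]]_N,
    [/\ f 0 = rho_a, f t = rho_b &
        forall (s : R) (i j : 'I_N),
          is_derive s 1 (fun x => complex.Re (f x i j)) (complex.Re (L (f s) i j))
          /\ is_derive s 1 (fun x => complex.Im (f x i j)) (complex.Im (L (f s) i j))].

(* Reachable set of Sigma_a from rho0 with piecewise-constant controls
   u(t) in R^m (unbounded) and gamma(t) in {0, gamma_star}: finitely many
   segments of nonnegative duration with constant control values. *)
Inductive q_reach (R : realType) (n' m : nat) (H0 : 'M[R[i]]_(qdim n'))
  (H : 'I_m -> 'M[R[i]]_(qdim n')) (gstar : R) (rho0 : 'M[R[i]]_(qdim n'))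
  : 'M[R[i]]_(qdim n') -> Prop :=
| q_reach_start : q_reach R n' m H0 H gstar rho0 rho0
| q_reach_step (rho1 rho2 : 'M[R[i]]_(qdim n')) (t : R) (u : 'I_m -> R) (g : R) :
    q_reach R n' m H0 H gstar rho0 rho1 -> 0 <= t -> (g = 0 \/ g = gstar) ->
    q_flow (q_generator n' m H0 H u g) t rho1 rho2 ->
    q_reach R n' m H0 H gstar rho0 rho2.

Definition q_imul {R : rcfType} {N : nat} (A : 'M[R[i]]_N) : 'M[R[i]]_N :=
  'i *: A.

(* Main.v *)
Require Import Defs.
From HB Require Import structures.
From mathcomp Require Import all_boot all_order all_algebra.
From mathcomp Require Import fingroup perm.
From mathcomp Require Import complex mxtens.
From mathcomp Require Import all_classical all_reals all_analysis.
From mathcomp Require Import ring lra zify.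
Import Order.TTheory GRing.Theory Num.Theory.
Import numFieldNormedType.Exports.
Local Open Scope ring_scope.
Local Open Scope complex_scope.
Local Open Scope sesquilinear_scope.
Set Implicit Arguments.
Unset Strict Implicit.
Unset Printing Implicit Defensive.

(* Let K be the closure of the reachable set; it consists of density operators. The unitaries U
   with U K U^* <= K form a closed semigroup of a compact group, hence a closed group, and its
   tangent directions at 1 form a Lie algebra containing every i H_j (the drift is reversible
   because of inverses); controllability then makes K invariant under all unitary conjugations.

   Given a target sigma, let rho be a point of K nearest to sigma in Hilbert-Schmidt norm.
   Stationarity along unitary orbits gives [rho, sigma] = 0, so both are diagonal in a common
   basis, with populations q and p. If q <> p, permute the levels so that every pair of levels
   coupled by the amplitude damping decays from the larger to the smaller value of q - p, one
   of them strictly. Switching the noise on then decreases the distance to first order (the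
   Hamiltonian drift contributes nothing at a diagonal state), contradicting minimality. *)

(** * Norm and derivative of complex matrices *)

(** The obstacle is that nothing can be done exactly: the drift [H0] can be neither switched off nor
    run backwards, and the noise never acts without some Hamiltonian. Passing to the closure removes
    both difficulties. Inverses and exponentials need only be limits of admissible evolutions, and a
    nearest point is attained because density matrices form a bounded set. The noise is then used
    only infinitesimally, at a single diagonal state, so no explicit scheme for transferring
    populations is needed. The squared Hilbert-Schmidt distance suits this argument: it is invariant
    under unitary conjugation, smooth, and its derivative at commuting states depends on populations
    alone. Confinement of the flow to density operators is proved for the differential equation
    itself, by a barrier at the boundary of the positive cone; it gives both the easy inclusion and
    the boundedness used for the nearest point. *)

Section EntrywiseNorm.
Context {R : realType}.
Implicit Types (m n p : nat) (z : R[i]).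

Definition cnorm z : R := ComplexField.Normc.normc z.

Lemma cnorm_ge0 z : 0 <= cnorm z.
Proof. by case: z => a b; exact: sqrtr_ge0. Qed.

Lemma cnorm0 : cnorm 0 = 0. Proof. exact: ComplexField.Normc.normc0. Qed.

Lemma cnormM z w : cnorm (z * w) = cnorm z * cnorm w.
Proof. exact: ComplexField.Normc.normcM. Qed.

Lemma cnormD z w : cnorm (z + w) <= cnorm z + cnorm w.
Proof. exact: le_normcD. Qed.

Lemma cnormN z : cnorm (- z) = cnorm z.
Proof. exact: normcN. Qed.

Lemma cnormJ z : cnorm (Num.conj z) = cnorm z.
Proof. by case: z => a b; rewrite /cnorm /= sqrrN. Qed.

Lemma cnorm_real (r : R) : cnorm r%:C = `|r|.
Proof. by rewrite /cnorm /= expr0n addr0 sqrtr_sqr. Qed.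

Lemma normE_cnorm z : `|z| = (cnorm z)%:C.
Proof. by rewrite normc_def; case: z. Qed.

Lemma abs_Re_le_cnorm z : `|complex.Re z| <= cnorm z.
Proof.
by case: z => a b; rewrite /cnorm /= -[leLHS]sqrtr_sqr ler_sqrt ?lerDl ?addr_ge0 ?sqr_ge0.
Qed.

Lemma abs_Im_le_cnorm z : `|complex.Im z| <= cnorm z.
Proof.
by case: z => a b; rewrite /cnorm /= -[leLHS]sqrtr_sqr ler_sqrt ?lerDr ?addr_ge0 ?sqr_ge0.
Qed.

Lemma cnorm_le_ReIm z : cnorm z <= `|complex.Re z| + `|complex.Im z|.
Proof.
case: z => a b; rewrite /cnorm /=.
rewrite -[leRHS]ger0_norm ?addr_ge0 // -sqrtr_sqr ler_sqrt ?sqr_ge0 //.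
rewrite sqrrD !real_normK ?num_real // lerD2r lerDl mulrn_wge0 //.
Qed.

(** The entrywise l1 norm: submultiplicative and adjoint-invariant with constant one, and it
    dominates every single entry. It is not unitarily invariant, which is why dimension constants
    appear later. *)
Definition mnorm {m n} (A : 'M[R[i]]_(m, n)) : R :=
  \sum_i \sum_j cnorm (A i j).

Lemma mnorm_ge0 m n (A : 'M[R[i]]_(m, n)) : 0 <= mnorm A.
Proof. by apply: sumr_ge0 => i _; apply: sumr_ge0 => j _; exact: cnorm_ge0. Qed.

Lemma mnorm0 m n : mnorm (0 : 'M[R[i]]_(m, n)) = 0.
Proof. by rewrite /mnorm big1 // => i _; rewrite big1 // => j _; rewrite mxE cnorm0. Qed.

Lemma cnorm_le_mnorm m n (A : 'M[R[i]]_(m, n)) i j : cnorm (A i j) <= mnorm A.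
Proof.
rewrite /mnorm (bigD1 i) //= (bigD1 j) //= -addrA lerDl addr_ge0 ?sumr_ge0 //.
  by move=> k _; exact: cnorm_ge0.
by move=> k _; apply: sumr_ge0 => l _; exact: cnorm_ge0.
Qed.

Lemma mnormD m n (A B : 'M[R[i]]_(m, n)) : mnorm (A + B) <= mnorm A + mnorm B.
Proof.
rewrite /mnorm -big_split; apply: ler_sum => i _ /=.
by rewrite -big_split; apply: ler_sum => j _; rewrite mxE cnormD.
Qed.

Lemma mnormZ m n c (A : 'M[R[i]]_(m, n)) : mnorm (c *: A) = cnorm c * mnorm A.
Proof.
rewrite /mnorm mulr_sumr; apply: eq_bigr => i _; rewrite mulr_sumr.
by apply: eq_bigr => j _; rewrite mxE cnormM.
Qed.

Lemma mnormN m n (A : 'M[R[i]]_(m, n)) : mnorm (- A) = mnorm A.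
Proof. by apply: eq_bigr => i _; apply: eq_bigr => j _; rewrite mxE cnormN. Qed.

Lemma mnorm_distC m n (A B : 'M[R[i]]_(m, n)) : mnorm (A - B) = mnorm (B - A).
Proof. by rewrite -mnormN opprB. Qed.

Lemma mnorm_adj m n (A : 'M[R[i]]_(m, n)) : mnorm (A^t*) = mnorm A.
Proof.
rewrite /mnorm exchange_big; apply: eq_bigr => i _; apply: eq_bigr => j _.
by rewrite !mxE cnormJ.
Qed.

Lemma cnorm_sum (I : Type) (r : seq I) (F : I -> R[i]) :
  cnorm (\sum_(i <- r) F i) <= \sum_(i <- r) cnorm (F i).
Proof.
elim/big_ind2: _ => [|x1 x2 y1 y2 h1 h2|//]; first by rewrite cnorm0.
by rewrite (le_trans (cnormD _ _))// lerD.
Qed.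

Lemma mnormM m n p (A : 'M[R[i]]_(m, n)) (B : 'M[R[i]]_(n, p)) :
  mnorm (A *m B) <= mnorm A * mnorm B.
Proof.
rewrite {1 2}/mnorm mulr_suml; apply: ler_sum => i _.
apply: (@le_trans _ _ (\sum_j \sum_k cnorm (A i k) * cnorm (B k j))).
  apply: ler_sum => j _; rewrite mxE (le_trans (cnorm_sum _ _)) //.
  by apply: ler_sum => k _; rewrite cnormM.
rewrite exchange_big mulr_suml; apply: ler_sum => k _ /=.
rewrite -mulr_sumr ler_wpM2l ?cnorm_ge0 // /mnorm (bigD1 k) //= lerDl.
by apply: sumr_ge0 => l _; apply: sumr_ge0 => j _; exact: cnorm_ge0.
Qed.

Lemma cnorm_eq0 z : cnorm z = 0 -> z = 0.
Proof. exact: ComplexField.Normc.eq0_normc. Qed.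

Lemma mnorm_eq0 m n (A : 'M[R[i]]_(m, n)) : (forall eps, 0 < eps -> mnorm A < eps) -> A = 0.
Proof.
move=> hA; apply/matrixP => i j; rewrite mxE; apply: cnorm_eq0.
apply/eqP; rewrite eq_le cnorm_ge0 andbT leNgt; apply/negP => h.
by have := hA _ h; rewrite ltNge cnorm_le_mnorm.
Qed.

Lemma mnorm_le_entry m n (A : 'M[R[i]]_(m, n)) b :
  (forall i j, cnorm (A i j) <= b) -> mnorm A <= (m * n)%:R * b.
Proof.
move=> hA; apply: (@le_trans _ _ (\sum_(i < m) \sum_(j < n) b)).
  by apply: ler_sum => i _; apply: ler_sum => j _.
by rewrite !sumr_const !card_ord -mulrnA mulr_natl mulnC.
Qed.

Lemma mnorm_triangle m n (B A D : 'M[R[i]]_(m, n)) :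
  mnorm (A - D) <= mnorm (A - B) + mnorm (B - D).
Proof. by rewrite (le_trans _ (mnormD _ _)) // addrA subrK. Qed.

End EntrywiseNorm.

Section Adjoint.
Context {R : realType}.
Implicit Types (m n p : nat).

Lemma q_adjE n (A : 'M[R[i]]_n) : q_adj A = A^t*.
Proof. by apply/matrixP => i j; rewrite !mxE. Qed.

Lemma q_vadjE n (v : 'cV[R[i]]_n) : q_vadj v = v^t*.
Proof. by apply/matrixP => i j; rewrite !mxE ord1. Qed.

Lemma adjM m n p (A : 'M[R[i]]_(m, n)) (B : 'M[R[i]]_(n, p)) :
  (A *m B)^t* = B^t* *m A^t*.
Proof. by rewrite trmx_mul map_mxM. Qed.

Lemma adjD m n (A B : 'M[R[i]]_(m, n)) : (A + B)^t* = A^t* + B^t*.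
Proof. by rewrite linearD map_mxD. Qed.

Lemma adjN m n (A : 'M[R[i]]_(m, n)) : (- A)^t* = - A^t*.
Proof. by rewrite linearN map_mxN. Qed.

Lemma adjB m n (A B : 'M[R[i]]_(m, n)) : (A - B)^t* = A^t* - B^t*.
Proof. by rewrite adjD adjN. Qed.

Lemma adjZ m n c (A : 'M[R[i]]_(m, n)) : (c *: A)^t* = Num.conj c *: A^t*.
Proof. by rewrite linearZ map_mxZ. Qed.

Lemma adj1 n : (1%:M : 'M[R[i]]_n)^t* = 1%:M.
Proof. by rewrite trmx1 map_mx1. Qed.

Lemma adj_diag n (d : 'rV[R[i]]_n) : (diag_mx d)^t* = diag_mx (map_mx Num.conj d).
Proof. by rewrite tr_diag_mx map_diag_mx. Qed.

Lemma conjC_real (r : R) : Num.conj r%:C = r%:C.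
Proof. by apply/eqP; rewrite eq_complex /= oppr0 !eqxx. Qed.

Lemma conjC_i : Num.conj ('i : R[i]) = - 'i.
Proof. by apply/eqP; rewrite eq_complex /= oppr0 !eqxx. Qed.

Lemma tr_adj n (A : 'M[R[i]]_n) : \tr (A^t*) = Num.conj (\tr A).
Proof. by rewrite /mxtrace rmorph_sum; apply: eq_bigr => i _; rewrite !mxE. Qed.

End Adjoint.

Section MatrixDerivative.
Context {R : realType}.
Implicit Types (m n p : nat) (s : R).

Definition cderiv (f : R -> R[i]) s (d : R[i]) : Prop :=
  is_derive s 1 (fun x => complex.Re (f x)) (complex.Re d) /\
  is_derive s 1 (fun x => complex.Im (f x)) (complex.Im d).

Lemma is_derive_congr (f g : R -> R) s (a b : R) :
  f =1 g -> a = b -> is_derive s 1 f a -> is_derive s 1 g b.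
Proof. by move=> /funext -> ->. Qed.

Lemma cderiv_congr f g s d e : f =1 g -> d = e -> cderiv f s d -> cderiv g s e.
Proof. by move=> /funext -> ->. Qed.

Lemma cderiv_cst c s : cderiv (fun=> c) s 0.
Proof. by split; exact: is_derive_cst. Qed.

Lemma ReD (z w : R[i]) : complex.Re (z + w) = complex.Re z + complex.Re w.
Proof. by case: z w => [? ?] [? ?]. Qed.

Lemma ImD (z w : R[i]) : complex.Im (z + w) = complex.Im z + complex.Im w.
Proof. by case: z w => [? ?] [? ?]. Qed.

Lemma ReM (z w : R[i]) :
  complex.Re (z * w) = complex.Re z * complex.Re w - complex.Im z * complex.Im w.
Proof. by case: z w => [? ?] [? ?]. Qed.

Lemma ImM (z w : R[i]) :
  complex.Im (z * w) = complex.Re z * complex.Im w + complex.Im z * complex.Re w.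
Proof. by case: z w => [? ?] [? ?]. Qed.

Lemma ReJ (z : R[i]) : complex.Re (Num.conj z) = complex.Re z.
Proof. by case: z. Qed.

Lemma ImJ (z : R[i]) : complex.Im (Num.conj z) = - complex.Im z.
Proof. by case: z. Qed.

Lemma cderivD f g s d e :
  cderiv f s d -> cderiv g s e -> cderiv (fun x => f x + g x) s (d + e).
Proof.
move=> [f1 f2] [g1 g2]; split.
  by apply: is_derive_congr (is_deriveD f1 g1) => [x|]; rewrite ReD.
by apply: is_derive_congr (is_deriveD f2 g2) => [x|]; rewrite ImD.
Qed.

Lemma cderivM f g s d e :
  cderiv f s d -> cderiv g s e ->
  cderiv (fun x => f x * g x) s (d * g s + f s * e).
Proof.
move=> [f1 f2] [g1 g2]; split.
- apply: is_derive_congr (is_deriveD (is_deriveM f1 g1) (is_deriveN (is_deriveM f2 g2))) => [x|].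
    by rewrite ReM.
  by rewrite ReD !ReM /GRing.scale /=; ring.
- apply: is_derive_congr (is_deriveD (is_deriveM f1 g2) (is_deriveM f2 g1)) => [x|].
    by rewrite ImM.
  by rewrite ImD !ImM /GRing.scale /=; ring.
Qed.

Lemma cderiv_conj f s d : cderiv f s d -> cderiv (fun x => Num.conj (f x)) s (Num.conj d).
Proof.
move=> [f1 f2]; split.
  by apply: is_derive_congr f1 => [x|]; rewrite ReJ.
by apply: is_derive_congr (is_deriveN f2) => [x|]; rewrite ImJ.
Qed.

Lemma cderiv_sum (I : Type) (r : seq I) (F : I -> R -> R[i]) s (D : I -> R[i]) :
  (forall i, cderiv (F i) s (D i)) ->
  cderiv (fun x => \sum_(i <- r) F i x) s (\sum_(i <- r) D i).
Proof.
move=> h; elim: r => [|k r ih].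
  by apply: cderiv_congr (cderiv_cst 0 s); [move=> x|]; rewrite big_nil.
by apply: cderiv_congr (cderivD (h k) ih); [move=> x|]; rewrite big_cons.
Qed.

Definition mderiv {m n} (f : R -> 'M[R[i]]_(m, n)) s (D : 'M[R[i]]_(m, n)) : Prop :=
  forall i j, cderiv (fun x => f x i j) s (D i j).

Lemma mderiv_congr m n (f g : R -> 'M[R[i]]_(m, n)) s D E :
  f =1 g -> D = E -> mderiv f s D -> mderiv g s E.
Proof. by move=> /funext -> ->. Qed.

Lemma mderiv_cst m n (A : 'M[R[i]]_(m, n)) s : mderiv (fun=> A) s 0.
Proof. by move=> i j; rewrite mxE; exact: cderiv_cst. Qed.

Lemma mderivD m n (f g : R -> 'M[R[i]]_(m, n)) s D E :
  mderiv f s D -> mderiv g s E -> mderiv (fun x => f x + g x) s (D + E).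
Proof.
move=> hf hg i j; apply: cderiv_congr (cderivD (hf i j) (hg i j)).
  by move=> x; rewrite mxE.
by rewrite mxE.
Qed.

Lemma mderivM m n p (f : R -> 'M[R[i]]_(m, n)) (g : R -> 'M[R[i]]_(n, p)) s D E :
  mderiv f s D -> mderiv g s E ->
  mderiv (fun x => f x *m g x) s (D *m g s + f s *m E).
Proof.
move=> hf hg i j; have h k := cderivM (hf i k) (hg k j).
apply: cderiv_congr (cderiv_sum _ h); first by move=> x; rewrite mxE.
by rewrite !mxE -big_split.
Qed.

Lemma mderiv_mull m n p (A : 'M[R[i]]_(m, n)) (f : R -> 'M[R[i]]_(n, p)) s D :
  mderiv f s D -> mderiv (fun x => A *m f x) s (A *m D).
Proof.
move=> hf; apply: mderiv_congr (mderivM (mderiv_cst A s) hf) => //.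
by rewrite mul0mx add0r.
Qed.

Lemma mderiv_mulr m n p (A : 'M[R[i]]_(n, p)) (f : R -> 'M[R[i]]_(m, n)) s D :
  mderiv f s D -> mderiv (fun x => f x *m A) s (D *m A).
Proof.
move=> hf; apply: mderiv_congr (mderivM hf (mderiv_cst A s)) => //.
by rewrite mulmx0 addr0.
Qed.

Lemma mderivZ m n c (f : R -> 'M[R[i]]_(m, n)) s D :
  mderiv f s D -> mderiv (fun x => c *: f x) s (c *: D).
Proof.
move=> hf; apply: mderiv_congr (mderiv_mull c%:M hf); last exact: mul_scalar_mx.
by move=> x; exact: mul_scalar_mx.
Qed.

Lemma mderivB m n (f g : R -> 'M[R[i]]_(m, n)) s D E :
  mderiv f s D -> mderiv g s E -> mderiv (fun x => f x - g x) s (D - E).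
Proof.
move=> hf /(mderivZ (-1)) hg; apply: mderiv_congr (mderivD hf hg).
  by move=> x; rewrite scaleN1r.
by rewrite scaleN1r.
Qed.

Lemma mderiv_adj m n (f : R -> 'M[R[i]]_(m, n)) s D :
  mderiv f s D -> mderiv (fun x => (f x)^t*) s (D^t*).
Proof.
move=> hf i j; apply: cderiv_congr (cderiv_conj (hf j i)) => [x|];
by rewrite !mxE.
Qed.

Lemma is_derive_littleo (h : R -> R) s (d : R) :
  is_derive s 1 h d -> forall eps, 0 < eps -> exists2 delta, 0 < delta &
    forall t, `|t| < delta -> `|h (s + t) - h s - t * d| <= eps * `|t|.
Proof.
move=> [hd hv] eps eps0.
have : (t^-1 *: ((h \o shift s) (t *: 1) - h s) @[t --> 0^'] --> d)%classic.
  by rewrite -hv; exact: hd.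
move=> /cvgrPdist_le /(_ eps eps0); rewrite /dnbhs /within /=.
move=> /nbhs_ballP[delta /= delta0 hdelta]; exists delta => // t tdelta.
have [->|t0] := eqVneq t 0.
  by rewrite addr0 subrr mul0r subr0 !normr0 mulr0.
have := hdelta t; rewrite /ball /= sub0r normrN => /(_ tdelta t0).
have tp : 0 < `|t| by rewrite normr_gt0.
rewrite -(ler_pM2r tp) -normrM => le.
rewrite (_ : _ - t * d = - ((d - t^-1 *: (h (t%:A + s) - h s)) * t)) ?normrN //.
by rewrite /GRing.scale /= mulr1 (addrC t s); field.
Qed.

Lemma is_derive_continuous (h : R -> R) s (d : R) :
  is_derive s 1 h d -> {for s, continuous h}.
Proof. by move=> [hd _]; apply: differentiable_continuous; exact/derivable1_diffP. Qed.

End MatrixDerivative.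

(** * Compactness and first-order expansions *)

Section Compactness.
Context {R : realType}.

(** One Bolzano-Weierstrass extraction per coordinate, by induction on the list. Recording
    [k <= phi k] is enough to carry eventual estimates over to the next extraction. *)
Lemma bounded_subseq_cvg (I : eqType) (s : seq I) (F : I -> nat -> R) b :
  (forall i k, `|F i k| <= b) ->
  exists phi : nat -> nat, (forall k, (k <= phi k)%N) /\
    {in s, forall i, exists l, forall eps, 0 < eps ->
      exists K, forall k, (K <= k)%N -> `|F i (phi k) - l| < eps}.
Proof.
move=> hb; elim: s => [|i s [phi [phi_ge hphi]]]; first by exists id.
have [|psi psi_incr /cvg_ex[l /cvgrPdist_lt hl]] :=
    @bolzano_weierstrass R (F i \o phi).
  exists b; split; first exact: num_real.
  by move=> x bx y _ /=; rewrite (le_trans (hb _ _)) // ltW.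
have psi_ge k : (k <= psi k)%N.
  elim: k => // k ih; apply: (leq_ltn_trans ih).
  by rewrite ltnNge; have := psi_incr k.+1 k; rewrite ltnn leEnat => ->.
exists (phi \o psi); split=> [k|j].
  exact: leq_trans (psi_ge k) (phi_ge _).
rewrite inE => /orP[/eqP->|js].
  exists l => eps /hl [K _ hK]; exists K => k Kk.
  by rewrite distrC; exact: hK.
have [l' hl'] := hphi j js; exists l' => eps /hl' [K hK]; exists K => k Kk.
exact/hK/(leq_trans Kk).
Qed.

(** The successor in the denominator keeps the final bound strict and the quotient meaningful even
    for matrices without entries. *)
Lemma mnorm_lt_ReIm m n (A : 'M[R[i]]_(m, n)) (eps : R) : 0 < eps ->
  (forall i j, `|complex.Re (A i j)| < eps / ((m * n).+1%:R * 2) /\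
               `|complex.Im (A i j)| < eps / ((m * n).+1%:R * 2)) ->
  mnorm A < eps.
Proof.
set d := eps / _ => eps0 hA.
apply: (@le_lt_trans _ _ ((m * n)%:R * (d + d))).
  apply: mnorm_le_entry => i j; apply: le_trans (cnorm_le_ReIm _) _.
  by have [/ltW ? /ltW ?] := hA i j; exact: lerD.
have -> : (m * n)%:R * (d + d) = eps * ((m * n)%:R / (m * n).+1%:R).
  suff E (a c : R) : c != 0 -> a * (eps / (c * 2) + eps / (c * 2)) = eps * (a / c).
    by rewrite E // pnatr_eq0.
  by move=> c0; field.
rewrite gtr_pMr // ltr_pdivrMr ?ltr0n // mul1r ltr_nat.
exact: ltnSn.
Qed.

(** The form in which compactness enters everywhere: for recurrent powers of a unitary, for a
    nearest point, and for a null direction at the first exit time from the positive cone. *)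
Lemma mnorm_cluster m n (u : nat -> 'M[R[i]]_(m, n)) b :
  (forall k, mnorm (u k) <= b) ->
  exists A, forall eps, 0 < eps -> forall K, exists2 k, (K <= k)%N & mnorm (u k - A) < eps.
Proof.
move=> hb.
pose F (x : 'I_m * 'I_n * bool) k : R :=
  if x.2 then complex.Re (u k x.1.1 x.1.2) else complex.Im (u k x.1.1 x.1.2).
have hF x k : `|F x k| <= b.
  rewrite /F; case: ifP => _; apply: le_trans (hb k);
  apply: le_trans (cnorm_le_mnorm _ _ _).
    exact: abs_Re_le_cnorm.
  exact: abs_Im_le_cnorm.
have [phi [phi_ge hphi]] := bounded_subseq_cvg (enum {: 'I_m * 'I_n * bool}) hF.
have /choice [l hl] : forall x, exists l, forall eps, 0 < eps ->
      exists K, forall k, (K <= k)%N -> `|F x (phi k) - l| < eps.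
  by move=> x; apply: hphi; rewrite mem_enum.
exists (\matrix_(i, j) (l (i, j, true) +i* l (i, j, false))) => eps eps0 K.
pose d : R := eps / ((m * n).+1%:R * 2).
have d0 : 0 < d by rewrite divr_gt0 // mulr_gt0.
have /choice [N hN] : forall x, exists K, forall k, (K <= k)%N -> `|F x (phi k) - l x| < d.
  by move=> x; exact: hl.
pose k := maxn K (\max_x N x).
have kx x : `|F x (phi k) - l x| < d.
  by apply: hN; rewrite leq_max (leq_bigmax x) orbT.
exists (phi k); first by rewrite (leq_trans _ (phi_ge _)) // leq_maxl.
apply: mnorm_lt_ReIm => // i j; rewrite !mxE; split.
  by have := kx (i, j, true); rewrite /F /= ; case: (u _ i j).
by have := kx (i, j, false); rewrite /F /= ; case: (u _ i j).
Qed.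

End Compactness.

Section Expansion.
Context {R : realType}.

Lemma uniform_delta (I : finType) (P : I -> R -> Prop) :
  (forall i, exists2 delta, 0 < delta & forall t, `|t| < delta -> P i t) ->
  exists2 delta, 0 < delta & forall t, `|t| < delta -> forall i, P i t.
Proof.
move=> h.
have /choice [d hd] : forall i, exists delta, 0 < delta /\ forall t, `|t| < delta -> P i t.
  by move=> i; have [e] := h i; exists e.
exists (\big[Order.min/1]_i d i).
  by elim/big_ind: _ => // [x y x0 y0|i _]; [rewrite lt_min x0 | have [] := hd i].
move=> t td i; apply: (hd i).2; apply: lt_le_trans td _; exact: bigmin_le_cond.
Qed.

Lemma cderiv_littleo (f : R -> R[i]) s d : cderiv f s d ->
  forall eps, 0 < eps -> exists2 delta, 0 < delta &
    forall t, `|t| < delta -> cnorm (f (s + t) - f s - t%:C * d) <= eps * `|t|.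
Proof.
move=> [h1 h2] eps eps0; have e2 : 0 < eps / 2 by rewrite divr_gt0.
have [d1 d10 k1] := is_derive_littleo h1 e2.
have [d2 d20 k2] := is_derive_littleo h2 e2.
exists (Order.min d1 d2); first by rewrite lt_min d10.
move=> t; rewrite lt_min => /andP[/k1 t1 /k2 t2].
rewrite (le_trans (cnorm_le_ReIm _)) //.
rewrite [eps in leRHS]splitr mulrDl; apply: lerD.
  apply: le_trans t1; rewrite le_eqVlt; apply/orP; left; apply/eqP; congr (`| _ |).
  by case: (f (s + t)) (f s) d {h1 h2 k1 k2 t2} => ? ? [? ?] [? ?] /=; rewrite mul0r subr0.
apply: le_trans t2; rewrite le_eqVlt; apply/orP; left; apply/eqP; congr (`| _ |).
by case: (f (s + t)) (f s) d {h1 h2 k1 k2 t1} => ? ? [? ?] [? ?] /=; rewrite mul0r addr0.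
Qed.

Lemma mderiv_littleo m n (f : R -> 'M[R[i]]_(m, n)) s D : mderiv f s D ->
  forall eps, 0 < eps -> exists2 delta, 0 < delta &
    forall t, `|t| < delta -> mnorm (f (s + t) - f s - t%:C *: D) <= eps * `|t|.
Proof.
move=> hf eps eps0; pose e : R := eps / (m * n).+1%:R.
have e0 : 0 < e by rewrite divr_gt0.
have [x|delta d0 hd] := @uniform_delta ('I_m * 'I_n)%type (fun x t =>
    cnorm (f (s + t) x.1 x.2 - f s x.1 x.2 - t%:C * D x.1 x.2) <= e * `|t|).
  exact: cderiv_littleo (hf x.1 x.2) _ e0.
exists delta => // t /hd ht.
apply: (@le_trans _ _ ((m * n)%:R * (e * `|t|))).
  by apply: mnorm_le_entry => i j; rewrite !mxE; exact: ht (i, j).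
rewrite mulrA ler_wpM2r // /e mulrCA ler_piMr ?(ltW eps0) //.
by rewrite ler_pdivrMr ?ltr0n // mul1r ler_nat leqnSn.
Qed.

Lemma mderiv_continuous m n (f : R -> 'M[R[i]]_(m, n)) s D : mderiv f s D ->
  forall eps, 0 < eps -> exists2 delta, 0 < delta &
    forall t, `|t| < delta -> mnorm (f (s + t) - f s) < eps.
Proof.
move=> /mderiv_littleo /(_ _ ltr01) [delta d0 hd] eps eps0.
(* With tolerance [1] the remainder is at most [|t|], so [M] is a local Lipschitz constant at
   [s]. *)
pose M := 1 + mnorm D.
have M0 : 0 < M by rewrite ltr_wpDr ?mnorm_ge0.
exists (Order.min delta (eps / M)); first by rewrite lt_min d0 divr_gt0.
move=> t; rewrite lt_min => /andP[/hd ht]; rewrite ltr_pdivlMr // => te.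
apply: le_lt_trans te; rewrite -[f (s + t) - f s](subrK (t%:C *: D)).
rewrite (le_trans (mnormD _ _)) // mnormZ cnorm_real /M mulrDr mulr1.
by rewrite lerD2r -[leRHS]mul1r.
Qed.

End Expansion.

(** * Linear differential equations *)

Section HilbertSchmidt.
Context {R : realType}.
Implicit Types (m n : nat).

(** The Euclidean inner product of the real and imaginary coordinates, that is, the real part of the
    Hilbert-Schmidt pairing. On columns it is the real part of the usual inner product, so the same
    calculus serves states and vectors. *)
Definition hs {m n} (A B : 'M[R[i]]_(m, n)) : R := complex.Re (\tr (A^t* *m B)).

Lemma hsE m n (A B : 'M[R[i]]_(m, n)) :
  hs A B = \sum_i \sum_j (complex.Re (A i j) * complex.Re (B i j) +
                          complex.Im (A i j) * complex.Im (B i j)).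
Proof.
rewrite /hs /mxtrace exchange_big /= raddf_sum; apply: eq_bigr => j _ /=.
rewrite mxE raddf_sum; apply: eq_bigr => i _ /=.
by rewrite ReM !mxE ReJ ImJ mulNr opprK.
Qed.

Lemma hsC m n (A B : 'M[R[i]]_(m, n)) : hs A B = hs B A.
Proof.
rewrite !hsE; apply: eq_bigr => i _; apply: eq_bigr => j _.
by rewrite mulrC [in X in _ + X]mulrC.
Qed.

Lemma hsDr m n (A B D : 'M[R[i]]_(m, n)) : hs A (B + D) = hs A B + hs A D.
Proof. by rewrite /hs mulmxDr linearD ReD. Qed.

Lemma hsZr m n r (A B : 'M[R[i]]_(m, n)) : hs A (r%:C *: B) = r * hs A B.
Proof. by rewrite /hs -scalemxAr linearZ ReM /= mul0r subr0. Qed.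

Lemma hsNr m n (A B : 'M[R[i]]_(m, n)) : hs A (- B) = - hs A B.
Proof.
have -> : - B = (-1)%:C *: B by rewrite rmorphN rmorph1 scaleN1r.
by rewrite hsZr mulN1r.
Qed.

Lemma hsBr m n (A B D : 'M[R[i]]_(m, n)) : hs A (B - D) = hs A B - hs A D.
Proof. by rewrite hsDr hsNr. Qed.

Lemma hs_ge0 m n (A : 'M[R[i]]_(m, n)) : 0 <= hs A A.
Proof.
by rewrite hsE; apply: sumr_ge0 => i _; apply: sumr_ge0 => j _; rewrite -!expr2 addr_ge0 ?sqr_ge0.
Qed.

Lemma hs_eq0 m n (A : 'M[R[i]]_(m, n)) : hs A A = 0 -> A = 0.
Proof.
rewrite hsE => /eqP; rewrite psumr_eq0 => [/allP h|i _]; last first.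
  by apply: sumr_ge0 => j _; rewrite -!expr2 addr_ge0 ?sqr_ge0.
apply/matrixP => i j; have /implyP/(_ isT) := h i (mem_index_enum _).
rewrite psumr_eq0 => [/allP/(_ j (mem_index_enum _))|k _]; last first.
  by rewrite -!expr2 addr_ge0 ?sqr_ge0.
rewrite -!expr2 paddr_eq0 ?sqr_ge0 // !sqrf_eq0 mxE => /andP[/eqP a /eqP b].
by apply/eqP; rewrite eq_complex a b /= !eqxx.
Qed.

Lemma cnorm_tr n (A : 'M[R[i]]_n) : cnorm (\tr A) <= mnorm A.
Proof.
rewrite (le_trans (cnorm_sum _ _)) //; apply: ler_sum => i _.
by rewrite (bigD1 i) //= lerDl; apply: sumr_ge0 => j _; exact: cnorm_ge0.
Qed.

Lemma abs_hs_le m n (A B : 'M[R[i]]_(m, n)) : `|hs A B| <= mnorm A * mnorm B.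
Proof.
rewrite (le_trans (abs_Re_le_cnorm _)) // (le_trans (cnorm_tr _)) //.
by rewrite (le_trans (mnormM _ _)) // mnorm_adj.
Qed.

(** Twice the gap between the two sides is the double sum of the squares [(a i - a j) ^+ 2]. *)
Lemma sqr_sum_le (I : finType) (a : I -> R) :
  (\sum_i a i) ^+ 2 <= #|I|%:R * \sum_i a i ^+ 2.
Proof.
rewrite -(ler_pM2l (_ : 0 < 2)) // expr2 mulr_suml.
have -> : 2 * (\sum_i (a i * \sum_j a j)) = \sum_i \sum_j 2 * (a i * a j).
  by rewrite mulr_sumr; apply: eq_bigr => i _; rewrite !mulr_sumr.
have -> : 2 * (#|I|%:R * \sum_i a i ^+ 2) = \sum_i \sum_j (a i ^+ 2 + a j ^+ 2).
  under [RHS]eq_bigr do rewrite big_split /= sumr_const.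
  rewrite big_split /= sumr_const sumrMnl /= mulr_natl.
  by rewrite mulr_natl mulr2n.
apply: ler_sum => i _; apply: ler_sum => j _.
by rewrite -subr_ge0 (_ : _ - _ = (a i - a j) ^+ 2) ?sqr_ge0 //; ring.
Qed.

Lemma mnorm_sqr_le m n (A : 'M[R[i]]_(m, n)) : mnorm A ^+ 2 <= (m * n)%:R * hs A A.
Proof.
rewrite /mnorm pair_big /= (le_trans (sqr_sum_le _)) // card_prod !card_ord.
rewrite ler_wpM2l // hsE pair_big /=; apply: ler_sum => -[i j] _ /=.
by case: (A i j) => a b; rewrite /cnorm /= sqr_sqrtr ?addr_ge0 ?sqr_ge0.
Qed.

Lemma is_derive_hs m n (f g : R -> 'M[R[i]]_(m, n)) s D E :
  mderiv f s D -> mderiv g s E ->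
  is_derive s 1 (fun x => hs (f x) (g x)) (hs D (g s) + hs (f s) E).
Proof.
move=> /mderiv_adj hf hg; have h := mderivM hf hg.
have [h1 _] := cderiv_sum (index_enum _) (fun i => h i i).
apply: is_derive_congr h1 => // .
by rewrite /hs -ReD -linearD.
Qed.

End HilbertSchmidt.

Section LinearODE.
Context {R : realType}.
Implicit Types (m n : nat).

Lemma derive_le0_nonincr (h h' : R -> R) :
  (forall s : R, is_derive s 1 h (h' s)) -> (forall s, 0 <= s -> h' s <= 0) ->
  forall t, 0 <= t -> h t <= h 0.
Proof.
move=> hd h0 t t0.
have [|c c0 /eqP] := @MVT_segment R h h' 0 t t0 (fun s _ => hd s).
  by apply: continuous_subspaceT => s; exact: is_derive_continuous (hd s).
rewrite subr_eq => /eqP ->; rewrite gerDr mulr_le0_ge0 ?subr0 //.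
by apply: h0; move: c0; rewrite in_itv /= => /andP[].
Qed.

Definition bounded_linear {m n} (L : 'M[R[i]]_(m, n) -> 'M[R[i]]_(m, n)) : Prop :=
  [/\ forall A B, L (A + B) = L A + L B,
      forall (r : R) A, L (r%:C *: A) = r%:C *: L A &
      exists2 b, 0 <= b & forall A, mnorm (L A) <= b * mnorm A].

Lemma bounded_linearB m n (L : 'M[R[i]]_(m, n) -> 'M[R[i]]_(m, n)) :
  bounded_linear L -> forall A B, L (A - B) = L A - L B.
Proof.
move=> [hD hZ _] A B; have E X : - X = (-1)%:C *: X :> 'M[R[i]]_(m, n).
  by rewrite rmorphN rmorph1 scaleN1r.
by rewrite (E B) hD hZ -E.
Qed.

(** The function [expR (- c * t) * hs (f t) (f t)] has nonpositive derivative. Since [c] is fixed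
    before [f], the estimate applied to a difference of solutions gives both uniqueness and
    Lipschitz dependence on the initial value. *)
Lemma hs_gronwall m n (L : 'M[R[i]]_(m, n) -> 'M[R[i]]_(m, n)) :
  bounded_linear L -> exists c, forall f, (forall s : R, mderiv f s (L (f s))) ->
    forall t, 0 <= t -> hs (f t) (f t) <= expR (c * t) * hs (f 0) (f 0).
Proof.
move=> [_ _ [b b0 hb]]; pose c : R := 2 * (b * (m * n)%:R); exists c => f hf.
have hc X : 2 * hs X (L X) <= c * hs X X.
  rewrite /c -mulrA ler_pM2l // (le_trans (ler_norm _)) // (le_trans (abs_hs_le _ _)) //.
  apply: (@le_trans _ _ (b * mnorm X ^+ 2)).
    by rewrite expr2 mulrCA ler_wpM2l // mnorm_ge0.
  by rewrite -mulrA ler_wpM2l // mnorm_sqr_le.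
pose h (s : R) := expR (- c * s) * hs (f s) (f s).
have hd (s : R) : is_derive s 1 h (expR (- c * s) * (2 * hs (f s) (L (f s)) - c * hs (f s) (f s))).
  have he : is_derive s 1 (fun x => expR (- c * x)) (expR (- c * s) * - c).
    apply: is_derive1_comp.
    apply: is_derive_congr (is_deriveZ (- c) (is_derive_id s (1 : R))) => //.
    by rewrite /GRing.scale /= mulr1.
  apply: is_derive_congr (is_deriveM he (is_derive_hs (hf s) (hf s))) => //.
  by rewrite [hs (L _) _]hsC /GRing.scale /=; ring.
move=> t t0; have := derive_le0_nonincr hd _ t0.
rewrite /h mulr0 expR0 mul1r mulNr expRN mulrC ler_pdivrMr ?expR_gt0 // mulrC; apply.
by move=> s _; rewrite mulr_ge0_le0 ?expR_ge0 // subr_le0.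
Qed.

Lemma ode_unique m n (L : 'M[R[i]]_(m, n) -> 'M[R[i]]_(m, n)) f g :
  bounded_linear L ->
  (forall s : R, mderiv f s (L (f s))) -> (forall s : R, mderiv g s (L (g s))) ->
  f 0 = g 0 -> forall t, 0 <= t -> f t = g t.
Proof.
move=> hL hf hg fg0 t t0; have [c hc] := hs_gronwall hL.
have hfg s : mderiv (fun x => f x - g x) s (L (f s - g s)).
  by rewrite (bounded_linearB hL); exact: mderivB.
have := hc _ hfg t t0; rewrite fg0 subrr {2}/hs mulmx0 linear0 mulr0 => h.
apply/eqP; rewrite -subr_eq0; apply/eqP/hs_eq0/eqP.
by rewrite eq_le h hs_ge0.
Qed.

Lemma exp_pseries_cvg (a : nat -> R) (M b : R) : 0 <= b ->
  (forall k, `|a k| <= M * (b ^+ k / k`!%:R)) -> forall x, cvgn (pseries a x).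
Proof.
move=> b0 ha x; apply: normed_cvg.
apply: (@series_le_cvg _ _ (fun k => M * exp_coeff (b * `|x|) k)).
- by move=> k /=.
- move=> k; apply: mulr_ge0.
    by have := le_trans (normr_ge0 _) (ha 0%N); rewrite expr0 fact0 divr1 mulr1.
  by rewrite /exp_coeff /= divr_ge0 // exprn_ge0 // mulr_ge0.
- move=> k /=; rewrite normrM normrX /exp_coeff /= exprMn.
  rewrite [X in M * X]mulrAC mulrA; apply: ler_wpM2r; first by rewrite exprn_ge0.
  exact: ha.
have -> : series (fun k => M * exp_coeff (b * `|x|) k) = M *: series (exp_coeff (b * `|x|)).
  by apply/funext => k; rewrite /series /= -mulr_sumr.
exact: (@is_cvgZl_tmp _ _ _ _ _ M _ (is_cvg_series_exp_coeff (b * `|x|))).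
Qed.

(** Termwise differentiation asks for convergence of the series and of its first two formal
    derivatives. An exponential-type bound passes to each formal derivative at the cost of a factor
    [b]. *)
Lemma is_derive_exp_pseries (a : nat -> R) (M b : R) : 0 <= b ->
  (forall k, `|a k| <= M * (b ^+ k / k`!%:R)) ->
  (forall k, `|pseries_diffs a k| <= (M * b) * (b ^+ k / k`!%:R)) ->
  (forall k, `|pseries_diffs (pseries_diffs a) k| <= (M * b * b) * (b ^+ k / k`!%:R)) ->
  forall x : R, is_derive x 1 (fun y => limn (pseries a y)) (limn (pseries (pseries_diffs a) x)).
Proof.
move=> b0 h0 h1 h2 x; apply: (@pseries_snd_diffs R a (`|x| + 1)).
- exact: exp_pseries_cvg b0 h0 _.
- exact: exp_pseries_cvg b0 h1 _.
- exact: exp_pseries_cvg b0 h2 _.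
by rewrite [ltRHS]ger0_norm ?addr_ge0 // ltrDl.
Qed.

(* The solution is the exponential series [\sum_k x^k / k! L^k A], differentiated termwise. *)
Lemma ode_exists m n (L : 'M[R[i]]_(m, n) -> 'M[R[i]]_(m, n)) A :
  bounded_linear L -> exists f, f 0 = A /\ forall s : R, mderiv f s (L (f s)).
Proof.
move=> hL; have [hD hZ [b b0 hb]] := hL.
pose c k := iter k L A.
have hc k l : mnorm (c (k + l)%N) <= mnorm A * b ^+ l * b ^+ k.
  elim: k => [|k ih].
    rewrite add0n expr0 mulr1; elim: l => [|l ih]; first by rewrite mulr1.
    by rewrite exprS mulrCA (le_trans (hb _)) // ler_wpM2l.
  by rewrite exprS mulrCA (le_trans (hb _)) // ler_wpM2l.
pose ser (u : nat -> 'M[R[i]]_(m, n)) (x : R) k : 'M[R[i]]_(m, n) :=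
  \sum_(0 <= l < k) (x ^+ l / l`!%:R)%:C *: u l.
pose re (l : nat) i j (k : nat) : R := complex.Re (c (k + l)%N i j) / k`!%:R.
pose im (l : nat) i j (k : nat) : R := complex.Im (c (k + l)%N i j) / k`!%:R.
have re_le l i j k : `|re l i j k| <= (mnorm A * b ^+ l) * (b ^+ k / k`!%:R).
  rewrite mulrA normrM [`|_^-1|]ger0_norm ?invr_ge0 // ler_wpM2r ?invr_ge0 //.
  exact: le_trans (abs_Re_le_cnorm _) (le_trans (cnorm_le_mnorm _ _ _) (hc k l)).
have im_le l i j k : `|im l i j k| <= (mnorm A * b ^+ l) * (b ^+ k / k`!%:R).
  rewrite mulrA normrM [`|_^-1|]ger0_norm ?invr_ge0 // ler_wpM2r ?invr_ge0 //.
  exact: le_trans (abs_Im_le_cnorm _) (le_trans (cnorm_le_mnorm _ _ _) (hc k l)).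
have diffs (F : nat -> R) : pseries_diffs (fun k => F k / k`!%:R) = (fun k => F k.+1 / k`!%:R).
  apply/funext => k; rewrite /pseries_diffs factS natrM invfM.
  by rewrite mulrCA mulVKf // pnatr_eq0.
have re_diffs l i j : pseries_diffs (re l i j) = re l.+1 i j.
  by rewrite /re diffs; apply/funext => k; rewrite addnS.
have im_diffs l i j : pseries_diffs (im l i j) = im l.+1 i j.
  by rewrite /im diffs; apply/funext => k; rewrite addnS.
(* [g l] is the exponential series started at the iterate [c l]. Differentiation is therefore the
   shift [l -> l.+1], and the differential equation reduces to [L (g 0 x) = g 1 x], which is checked
   on partial sums. *)
pose g l (x : R) : 'M[R[i]]_(m, n) :=
  \matrix_(i, j) (limn (pseries (re l i j) x) +i* limn (pseries (im l i j) x)).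
have g_deriv l x : mderiv (g l) x (g l.+1 x).
  have e k : mnorm A * b ^+ k * b = mnorm A * b ^+ k.+1 by rewrite -mulrA -exprSr.
  move=> i j; split.
    apply: is_derive_congr (is_derive_exp_pseries b0 (re_le l i j) _ _ x).
    - by move=> y; rewrite mxE.
    - by rewrite mxE re_diffs.
    - by rewrite re_diffs e; exact: re_le.
    - by rewrite !re_diffs !e; exact: re_le.
  apply: is_derive_congr (is_derive_exp_pseries b0 (im_le l i j) _ _ x).
  - by move=> y; rewrite mxE.
  - by rewrite mxE im_diffs.
  - by rewrite im_diffs e; exact: im_le.
  - by rewrite !im_diffs !e; exact: im_le.
have ser_g l x eps : 0 < eps -> exists K, forall k, (K <= k)%N ->
    mnorm (g l x - ser (fun k => c (k + l)%N) x k) < eps.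
  move=> eps0; pose d := eps / ((m * n).+1%:R * 2).
  have d0 : 0 < d by rewrite divr_gt0 // mulr_gt0.
  pose s (y : 'I_m * 'I_n * bool) := pseries (if y.2 then re l y.1.1 y.1.2 else im l y.1.1 y.1.2) x.
  have /choice [N hN] : forall y, exists K, forall k, (K <= k)%N ->
      `|limn (s y) - s y k| < d.
    move=> y; have : cvgn (s y).
      by rewrite /s; case: ifP => _; apply: (exp_pseries_cvg b0); [exact: re_le|exact: im_le].
    by move=> /cvgrPdist_lt /(_ _ d0) [K _ hK]; exists K => k; exact: hK.
  exists (\max_y N y) => k Nk.
  have sk y : `|limn (s y) - s y k| < d.
    by apply: hN; apply: leq_trans Nk; exact: leq_bigmax.
  apply: mnorm_lt_ReIm => // i j.
  have serE : ser (fun k => c (k + l)%N) x k i j =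
              s (i, j, true) k +i* s (i, j, false) k.
    rewrite /ser summxE; apply/eqP; rewrite eq_complex; apply/andP; split; apply/eqP.
      rewrite raddf_sum /=; apply: eq_bigr => q _.
      by rewrite mxE ReM /= mul0r subr0 /re; ring.
    rewrite raddf_sum /=; apply: eq_bigr => q _.
    by rewrite mxE ImM /= mul0r addr0 /im; ring.
  rewrite !mxE serE; split; [exact: (sk (i, j, true)) | exact: (sk (i, j, false))].
have L0 : L 0 = 0 by have := bounded_linearB hL 0 0; rewrite !subrr.
have ser_L x k : L (ser (fun k => c (k + 0)%N) x k) = ser (fun k => c (k + 1)%N) x k.
  elim: k => [|k ih]; first by rewrite /ser !big_geq.
  by rewrite /ser !big_nat_recr //= hD hZ ih addn0 addn1.
exists (g 0%N); split.
  apply/eqP; rewrite -subr_eq0; apply/eqP; apply: mnorm_eq0 => eps /(ser_g 0%N 0) [K hK].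
  have := hK K.+1 (leqnSn _); rewrite /ser big_nat_recl // big1 => [|k _].
    by rewrite addr0 expr0 fact0 divr1 rmorph1 scale1r addn0.
  by rewrite exprS mul0r mul0r scale0r.
move=> x; suff -> : L (g 0%N x) = g 1%N x by exact: g_deriv.
apply/eqP; rewrite -subr_eq0; apply/eqP; apply: mnorm_eq0 => eps eps0.
have e2 : 0 < eps / 2 by rewrite divr_gt0.
have e2b : 0 < eps / 2 / (b + 1) by rewrite divr_gt0 // ltr_wpDl.
have [K1 h1] := ser_g 0%N x _ e2b; have [K2 h2] := ser_g 1%N x _ e2.
have {h1} := h1 _ (leq_maxl K1 K2); have {h2} := h2 _ (leq_maxr K1 K2).
set k := maxn K1 K2; rewrite mnorm_distC => h2 h1.
apply: le_lt_trans (mnorm_triangle (L (ser (fun k => c (k + 0)%N) x k)) _ _) _.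
rewrite [eps]splitr {2}ser_L; apply: ler_ltD => //.
rewrite -(bounded_linearB hL) (le_trans (hb _)) //.
apply: (@le_trans _ _ ((b + 1) * (eps / 2 / (b + 1)))).
  apply: ler_pM => //; [exact: mnorm_ge0 | by rewrite lerDl | exact: ltW].
by rewrite mulrC divfK // gt_eqF // ltr_wpDl.
Qed.

End LinearODE.

(** * Lindblad generators and positivity *)

Section Positivity.
Context {R : realType}.
Implicit Types (N : nat).

Lemma hsDl m n (A B D : 'M[R[i]]_(m, n)) : hs (A + B) D = hs A D + hs B D.
Proof. by rewrite hsC hsDr ![hs D _]hsC. Qed.

Lemma hsZl m n r (A B : 'M[R[i]]_(m, n)) : hs (r%:C *: A) B = r * hs A B.
Proof. by rewrite hsC hsZr hsC. Qed.

Lemma hsBl m n (A B D : 'M[R[i]]_(m, n)) : hs (A - B) D = hs A D - hs B D.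
Proof. by rewrite hsC hsBr ![hs D _]hsC. Qed.

Lemma hs0r m n (A : 'M[R[i]]_(m, n)) : hs A 0 = 0.
Proof. by rewrite /hs mulmx0 linear0. Qed.

Lemma hs_mull m n p (A : 'M[R[i]]_(m, n)) (B : 'M[R[i]]_(m, p)) (D : 'M[R[i]]_(p, n)) :
  hs A (B *m D) = hs (B^t* *m A) D.
Proof. by rewrite /hs adjM trmxCK mulmxA. Qed.

Definition psd N (X : 'M[R[i]]_N) : Prop := forall v : 'cV[R[i]]_N, 0 <= hs v (X *m v).

(** Nonnegativity of a complex number includes being real; hermiticity supplies that part, so
    positivity reduces to a statement about real parts. *)
Lemma q_densityP N (X : 'M[R[i]]_N) :
  q_density X <-> [/\ X^t* = X, psd X & \tr X = 1].
Proof.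
have E (v : 'cV[R[i]]_N) : hs v (X *m v) = complex.Re ((q_vadj v *m X *m v) 0 0).
  by rewrite /hs q_vadjE -mulmxA /mxtrace big_ord1.
rewrite /q_density /q_hermitian q_adjE; split=> -[hX pX tX]; split=> // v.
  by rewrite E; have := pX v; rewrite lecE => /andP[].
rewrite lecE /=; apply/andP; split; last by rewrite -E.
have : Num.conj ((q_vadj v *m X *m v) 0 0) = (q_vadj v *m X *m v) 0 0.
  transitivity (((q_vadj v *m X *m v)^t*) 0 0); first by rewrite !mxE.
  by rewrite q_vadjE !adjM trmxCK hX mulmxA.
by case: (_ 0 0) => a b [/eqP]; rewrite eq_sym -subr_eq0 opprK -mulr2n mulrn_eq0.
Qed.

(** A zero of the quadratic form is a minimum of it, so moving from [v] in the direction [X *m v]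
    cannot have a first-order effect. *)
Lemma psd_kernel N (X : 'M[R[i]]_N) (v : 'cV[R[i]]_N) :
  X^t* = X -> psd X -> hs v (X *m v) = 0 -> X *m v = 0.
Proof.
move=> hX pX hv; apply: hs_eq0; set w := X *m v.
have h r : 0 <= 2 * r * hs w w + r ^+ 2 * hs w (X *m w).
  have := pX (v + r%:C *: w).
  rewrite mulmxDr -scalemxAr !hsDl !hsDr !hsZl !hsZr hv -/w (hs_mull v) hX -/w.
  by congr (_ <= _); ring.
have := pX w; have := hs_ge0 w; move: h.
move: (hs w w) (hs w (X *m w)) => p q h p0 q0.
apply/eqP; rewrite eq_le p0 andbT leNgt; apply/negP => {}p0.
have q1 : 0 < q + 1 by rewrite ltr_wpDl.
(* Almost the minimiser [- p / q] of the quadratic in [r]; the [+ 1] covers [q = 0]. *)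
have := h (- (p / (q + 1))); rewrite leNgt => /negP; apply.
have -> : 2 * - (p / (q + 1)) * p + (- (p / (q + 1))) ^+ 2 * q
   = - (p ^+ 2 * (q + 2) / (q + 1) ^+ 2) by field; rewrite gt_eqF.
by rewrite oppr_lt0 divr_gt0 ?exprn_gt0 // mulr_gt0 ?exprn_gt0 // ltr_wpDl.
Qed.

Lemma is_derive_gt0_left (h : R -> R) (s d : R) : is_derive s 1 h d -> 0 < d ->
  exists2 delta, 0 < delta & forall t, 0 < t -> t < delta -> h (s - t) < h s.
Proof.
move=> /is_derive_littleo hd d0; have d2 : 0 < d / 2 by rewrite divr_gt0.
have [delta delta0 hdelta] := hd _ d2; exists delta => // t t0 td.
have := hdelta (- t); rewrite normrN gtr0_norm // => /(_ td).
move=> /(le_trans (ler_norm _)); rewrite -subr_ge0.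
have : 0 < d / 2 * t by rewrite mulr_gt0.
by set a := h (s - t); set b := h s; lra.
Qed.

Variables (N : nat) (G V : 'M[R[i]]_N) (gam : R).
Hypothesis gam_ge0 : 0 <= gam.

(** The generator as an effective non-Hermitian drift [G] acting from both sides plus a jump term.
    This shape separates what matters for positivity, the jump term, from what is fixed by trace
    preservation, the hermitian part of [G]. *)
Definition lindblad X := G *m X + X *m G^t* + gam%:C *: (V *m X *m V^t*).

Lemma lindblad_bounded : bounded_linear lindblad.
Proof.
split=> [A B|r A|].
- rewrite /lindblad !mulmxDr !mulmxDl scalerDr.
  by rewrite (addrACA (G *m A)) [LHS]addrACA.
- rewrite /lindblad -!scalemxAr -!scalemxAl !scalerDr; congr (_ + _).
  by rewrite !scalerA mulrC.
exists (mnorm G + mnorm G + gam * (mnorm V * mnorm V)).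
  by rewrite !addr_ge0 ?mnorm_ge0 // mulr_ge0 // mulr_ge0 ?mnorm_ge0.
move=> A; rewrite !mulrDl (le_trans (mnormD _ _)) // lerD //.
  rewrite (le_trans (mnormD _ _)) // lerD //; first exact: mnormM.
  by rewrite (le_trans (mnormM _ _)) // mnorm_adj mulrC.
rewrite mnormZ cnorm_real ger0_norm // -mulrA ler_wpM2l // (le_trans (mnormM _ _)) //.
by rewrite mnorm_adj mulrAC ler_wpM2r ?mnorm_ge0 // mnormM.
Qed.

Lemma lindblad_adj X : (lindblad X)^t* = lindblad (X^t*).
Proof.
rewrite /lindblad !adjD adjZ !adjM !trmxCK conjC_real mulmxA.
rewrite (addrC (X^t* *m G^t*)); reflexivity.
Qed.

Section Solution.
Variable f : R -> 'M[R[i]]_N.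
Hypothesis f_deriv : forall s : R, mderiv f s (lindblad (f s)).

Lemma lindblad_flow_herm : (f 0)^t* = f 0 -> forall t, 0 <= t -> (f t)^t* = f t.
Proof.
move=> f0 t t0.
apply: (@ode_unique _ _ _ lindblad (fun s => (f s)^t*) f lindblad_bounded _ f_deriv f0 t t0).
by move=> s; rewrite -lindblad_adj; exact: mderiv_adj (f_deriv s).
Qed.

Lemma lindblad_flow_tr : G + G^t* + gam%:C *: (V^t* *m V) = 0 ->
  forall t, \tr (f t) = \tr (f 0).
Proof.
move=> hG t; have tr0 X : \tr (lindblad X) = 0.
  rewrite /lindblad !linearD linearZ /= [\tr (X *m _)]mxtrace_mulC -mulmxA [\tr (V *m _)]mxtrace_mulC.
  rewrite -mulmxA [\tr (X *m _)]mxtrace_mulC -linearZ -!linearD /= scalemxAl -!mulmxDl.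
  by rewrite hG mul0mx linear0.
have hd (s : R) : cderiv (fun x => \tr (f x)) s 0.
  by rewrite -(tr0 (f s)); apply: (cderiv_sum (index_enum _) (fun i => f_deriv s i i)).
apply/eqP; rewrite eq_complex.
rewrite (is_derive_0_is_cst t 0 (fun s => (hd s).1)).
by rewrite (is_derive_0_is_cst t 0 (fun s => (hd s).2)) !eqxx.
Qed.

End Solution.
End Positivity.

Lemma ex_lt_both (R : realFieldType) (d e : R) : 0 < d -> 0 < e ->
  exists h, [/\ 0 < h, h < d & h < e].
Proof.
move=> d0 e0; exists (Order.min d e / 2); split.
- by rewrite divr_gt0 // lt_min d0.
- rewrite ltr_pdivrMr // (@le_lt_trans _ _ d) ?ge_min ?lexx //; lra.
- rewrite ltr_pdivrMr // (@le_lt_trans _ _ e) ?ge_min ?lexx ?orbT //; lra.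
Qed.

Lemma telescopeB (R : realFieldType) (a b c d : R) :
  d - a = - (a - b) - (b - c) - (c - d).
Proof. ring. Qed.

Lemma telescope_gt0 (R : realFieldType) (e q1 q2 q3 q4 q5 : R) :
  e - q1 = - q2 - q3 - q4 -> - (e / 2) < q2 -> - q5 <= q3 -> - q5 <= q4 ->
  q5 * 2 < e / 2 -> 0 < q1.
Proof. lra. Qed.

(** * Invariance of the positive cone under an inward-pointing linear flow *)

Section Barrier.
Context {R : realType} (N : nat) (L : 'M[R[i]]_N -> 'M[R[i]]_N).
Hypothesis L_bounded : bounded_linear L.
Hypothesis L_boundary : forall (X : 'M[R[i]]_N) (v : 'cV[R[i]]_N),
  X^t* = X -> psd X -> X *m v = 0 -> 0 <= hs v (L X *m v).
Variable f : R -> 'M[R[i]]_N.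
Hypothesis f_deriv : forall s : R, mderiv f s (L (f s)).
Hypothesis f_herm : forall t, 0 <= t -> (f t)^t* = f t.
Hypothesis f_psd0 : psd (f 0).

Let c : R := N%:R * (mnorm (L 1%:M) + 1).

(* A strict supersolution: the growth rate [c] beats [L 1] in every direction, so the flow
   points strictly inwards wherever the barrier touches the boundary of the positive cone. *)
Definition barrier eps (s : R) : 'M[R[i]]_N := f s + (eps * expR (c * s))%:C *: 1%:M.

Lemma barrier_deriv eps (s : R) :
  mderiv (barrier eps) s (L (barrier eps s) +
    (eps * expR (c * s))%:C *: (c%:C *: 1%:M - L 1%:M)).
Proof.
rewrite /barrier; move: c => d.
have [hD hZ _] := L_bounded.
have he : is_derive s 1 (fun x => eps * expR (d * x)) (eps * (expR (d * s) * d)).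
  have hc : is_derive s (1 : R) (fun x => d * x) d.
    apply: is_derive_congr (is_deriveZ d (is_derive_id s (1 : R))) => //.
    by rewrite /GRing.scale /= mulr1.
  by have := is_deriveZ eps (is_derive1_comp (is_derive_expR _) hc).
have hc : cderiv (fun x => (eps * expR (d * x))%:C) s (eps * (expR (d * s) * d))%:C.
  by split => //=; exact: is_derive_cst.
have h1 : mderiv (fun x => (eps * expR (d * x))%:C *: (1%:M : 'M[R[i]]_N)) s
     ((eps * (expR (d * s) * d))%:C *: 1%:M).
  move=> i j; apply: cderiv_congr (cderivM hc (cderiv_cst ((1%:M : 'M[R[i]]_N) i j) s)).
    by move=> x; rewrite [RHS]mxE.
  by rewrite [RHS]mxE mulr0 addr0.
have h2 := mderivD (f_deriv s) h1; apply: (mderiv_congr _ _ h2); first by move=> x.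
rewrite hD hZ scalerBr scalerA -rmorphM /= -(mulrA eps).
have key (A B D : 'M[R[i]]_N) : A + D = A + B + (D - B).
  by rewrite -addrA [B + _]addrC subrK.
exact: key.
Qed.

(** First-exit argument. At the infimum [t0] of the times where strict positivity fails, compactness
    of unit vectors gives a [v] on which the form is not positive; continuity from earlier times
    makes the form nonnegative at [t0], so [v] is a kernel vector. The derivative in the direction
    [v] is strictly positive there, which would make the form negative shortly before [t0]. *)
Lemma barrier_pos eps : 0 < eps -> forall t, 0 <= t ->
  forall v : 'cV[R[i]]_N, v != 0 -> 0 < hs v (barrier eps t *m v).
Proof.
move=> eps0.
pose g' (s : R) := L (barrier eps s) + (eps * expR (c * s))%:C *: (c%:C *: 1%:M - L 1%:M).
have hb (s : R) : mderiv (barrier eps) s (g' s) := barrier_deriv eps s.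
have hherm s : 0 <= s -> (barrier eps s)^t* = barrier eps s.
  by move=> s0; rewrite /barrier adjD f_herm // adjZ adj1 conjC_real.
have b0 (w : 'cV[R[i]]_N) : w != 0 -> 0 < hs w (barrier eps 0 *m w).
  move=> w0; rewrite /barrier mulmxDl hsDr ltr_wpDl ?(f_psd0 w) //.
  rewrite mulr0 expR0 mulr1 -scalemxAl mul1mx hsZr mulr_gt0 //.
  rewrite lt_neqAle hs_ge0 andbT eq_sym; apply: contra w0 => /eqP h.
  by apply/eqP; exact: hs_eq0.
have hin (s : R) (w : 'cV[R[i]]_N) : 0 <= s -> mnorm w = 1 -> psd (barrier eps s) ->
    barrier eps s *m w = 0 ->
    0 < hs w (g' s *m w).
  move=> s0 w1 ps pw; rewrite /g' mulmxDl hsDr ltr_wpDl ?L_boundary ?hherm //.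
  rewrite -scalemxAl hsZr mulr_gt0 ?mulr_gt0 ?expR_gt0 //.
  rewrite mulmxBl hsBr -scalemxAl mul1mx hsZr subr_gt0.
  (* A column of entrywise norm one satisfies [1 <= N * hs w w]; this is the origin of the factor
     [N] in [c]. *)
  have := mnorm_sqr_le w; rewrite w1 expr1n muln1 => hw.
  apply: (@le_lt_trans _ _ (mnorm (L 1%:M))).
    rewrite (le_trans (ler_norm _)) // (le_trans (abs_hs_le _ _)) // w1 mul1r.
    by rewrite (le_trans (mnormM _ _)) // w1 mulr1.
  apply: (@lt_le_trans _ _ (mnorm (L 1%:M) + 1)); first by rewrite ltrDl.
  rewrite /c mulrAC ler_peMl // addr_ge0 ?mnorm_ge0 //.
clearbody g'; move: (barrier eps) hb hherm b0 hin => g hg hherm b0 hin.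
pose a s (w : 'cV[R[i]]_N) := hs w (g s *m w).
have ha (s : R) w : is_derive s 1 (fun x => a x w) (hs w (g' s *m w)).
  apply: is_derive_congr (is_derive_hs (mderiv_cst w s) (mderiv_mulr w (hg s))) => //.
  by rewrite hsC hs0r add0r.
have aZ s w r : a s (r%:C *: w) = r ^+ 2 * a s w.
  by rewrite /a -scalemxAr hsZl hsZr mulrA.
have mnorm_gt0 (w : 'cV[R[i]]_N) : w != 0 -> 0 < mnorm w.
  move=> w0; rewrite lt_neqAle mnorm_ge0 andbT eq_sym; apply: contra w0 => /eqP w0.
  by apply/eqP/mnorm_eq0 => e; rewrite w0.
pose Bad := [set s | 0 <= s /\ exists w, mnorm w = 1 /\ a s w <= 0]%classic.
have badP s w : 0 <= s -> w != 0 -> a s w <= 0 -> Bad s.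
  move=> s0 w0 asw; split => //; exists ((mnorm w)^-1%:C *: w); split.
    by rewrite mnormZ cnorm_real ger0_norm ?invr_ge0 ?mnorm_ge0 // mulVf // gt_eqF // mnorm_gt0.
  by rewrite aZ mulr_ge0_le0 // sqr_ge0.
move=> t t0 v v0; rewrite ltNge; apply/negP => /(badP _ _ t0 v0) bt {t0 v0 v}.
have infB : has_inf Bad by split; [exists t | exists 0 => s []].
pose t0 := inf Bad.
have t00 : 0 <= t0 by apply: lb_le_inf; [exists t | move=> s []].
have good s w : 0 <= s -> s < t0 -> w != 0 -> 0 < a s w.
  move=> s0 st w0; rewrite ltNge; apply/negP => /(badP _ _ s0 w0) bs.
  by move: st; rewrite ltNge; move/negP; apply; apply: ge_inf => //; case: infB.
have /choice [x hx] : forall k : nat, exists x : R * 'cV[R[i]]_N,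
    [/\ t0 <= x.1, x.1 < t0 + k.+1%:R^-1, mnorm x.2 = 1 & a x.1 x.2 <= 0].
  move=> k; have k0 : 0 < k.+1%:R^-1 :> R by rewrite invr_gt0.
  have [s bs st] := inf_adherent k0 infB.
  have [s0 [w [w1 w2]]] := bs.
  by exists (s, w); split => //=; apply: ge_inf => //; case: infB.
have [|v hv] := @mnorm_cluster R _ _ (fun k => (x k).2) 1.
  by move=> k; case: (hx k) => _ _ ->.
have v1 : mnorm v = 1.
  apply/eqP; rewrite -subr_eq0 -normr_le0 leNgt; apply/negP => e0.
  have [k _] := hv _ e0 0%N; rewrite ltNge => /negP; apply.
  have [_ _ <- _] := hx k; rewrite real_ler_norml ?num_real //.
  rewrite lerNl opprB !lerBlDr; apply/andP; split.
    by have := mnorm_triangle v (x k).2 0; rewrite !subr0.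
  by have := mnorm_triangle (x k).2 v 0; rewrite !subr0 (mnorm_distC v).
have v0 : v != 0.
  by apply/eqP => v0; move: v1; rewrite v0 mnorm0 => /esym/eqP; rewrite oner_eq0.
(* The limit is taken jointly in time and direction: the change from [a s w] to [a t0 v] is split
   into one term for the time and two for the two occurrences of the vector. *)
have av : a t0 v <= 0.
  rewrite leNgt; apply/negP => eta0; set eta := a t0 v in eta0.
  pose M := mnorm (g t0) * 2 + 1; have M0 : 0 < M by rewrite ltr_wpDl ?mulr_ge0 ?mnorm_ge0.
  have e2 : 0 < eta / 2 by rewrite divr_gt0.
  have [d d0 hd] := mderiv_continuous (hg t0) e2.
  have [K hK] : exists K : nat, K.+1%:R^-1 < d.
    exists (Num.trunc d^-1); rewrite -[ltRHS]invrK ltf_pV2 ?posrE ?invr_gt0 //.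
    have di : 0 <= d^-1 by rewrite invr_ge0 ltW.
    by have /andP[_] := truncn_itv di.
  have e3 : 0 < eta / 2 / M by rewrite divr_gt0.
  have [k Kk hk] := hv _ e3 K.
  have [xt tx x1 ax] := hx k; move: hk x1 xt tx ax; case: (x k) => s w /= hk w1 ts st aw.
  have {}hd : mnorm (g s - g t0) < eta / 2.
    have := hd (s - t0); rewrite (addrC t0) subrK; apply.
    rewrite ger0_norm ?subr_ge0 // ltrBlDl (lt_trans st) // ltrD2l.
    by apply: le_lt_trans hK; rewrite lef_pV2 ?posrE // ler_nat.
  have E : eta - a s w = - hs w ((g s - g t0) *m w) - hs w (g t0 *m (w - v))
                       - hs (w - v) (g t0 *m v).
    rewrite /eta /a mulmxBl mulmxBr !hsBr !hsBl; exact: telescopeB.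
  have b1 : `|hs w ((g s - g t0) *m w)| < eta / 2.
    rewrite (le_lt_trans (abs_hs_le _ _)) // w1 mul1r (le_lt_trans (mnormM _ _)) //.
    by rewrite w1 mulr1.
  have b2 : `|hs w (g t0 *m (w - v))| <= mnorm (g t0) * mnorm (w - v).
    by rewrite (le_trans (abs_hs_le _ _)) // w1 mul1r mnormM.
  have b3 : `|hs (w - v) (g t0 *m v)| <= mnorm (g t0) * mnorm (w - v).
    rewrite (le_trans (abs_hs_le _ _)) // mulrC ler_wpM2r ?mnorm_ge0 //.
    by rewrite (le_trans (mnormM _ _)) // v1 mulr1.
  have b4 : M * mnorm (w - v) < eta / 2 by rewrite mulrC -ltr_pdivlMr.
  move: b1 b2 b3; rewrite !ler_norml ltr_norml => /andP[b1 _] /andP[b2 _] /andP[b3 _].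
  have b5 : mnorm (g t0) * mnorm (w - v) * 2 < eta / 2.
    apply: le_lt_trans b4; rewrite /M mulrDl mul1r mulrAC lerDl; exact: mnorm_ge0.
  by have := telescope_gt0 E b1 b2 b3 b5; rewrite ltNge aw.
have t0_gt0 : 0 < t0.
  rewrite lt_neqAle t00 andbT; apply/eqP => E; move: av.
  by rewrite leNgt /a -E b0.
have at0 (w : 'cV[R[i]]_N) : 0 <= a t0 w.
  rewrite leNgt; apply/negP => aw.
  have w0 : w != 0 by apply: contraTneq aw => ->; rewrite /a mulmx0 hs0r ltxx.
  have := ha t0 w; move=> /is_derive_continuous /cvgrPdist_lt.
  have aw' : 0 < - a t0 w by rewrite oppr_gt0.
  move=> /(_ _ aw') /nbhs_ballP[d /= d0 hd].
  have [h [h0 hd' ht]] := ex_lt_both d0 t0_gt0.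
  have := hd (t0 - h); rewrite /ball /= opprB addrCA subrr addr0 gtr0_norm // => /(_ hd').
  have := good (t0 - h) w; rewrite subr_ge0 ltrBlDr ltrDl => /(_ (ltW ht) h0 w0).
  rewrite ltr_norml => ag /andP[al _].
  by move: al; rewrite opprK ltrDl oppr_gt0 => /(lt_trans ag); rewrite ltxx.
have at0v : a t0 v = 0 by apply/eqP; rewrite eq_le av at0.
have gv : g t0 *m v = 0 by apply: psd_kernel => //; exact: hherm.
have [d d0 hd] := is_derive_gt0_left (ha t0 v) (hin t0 v t00 v1 at0 gv).
have [h [h0 hd' ht]] := ex_lt_both d0 t0_gt0.
have := hd h h0 hd'; rewrite at0v ltNge => /negP; apply.
by apply/ltW/good => //; rewrite ?subr_ge0 ?(ltW ht) // ltrBlDr ltrDl.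
Qed.

Lemma psd_flow t : 0 <= t -> psd (f t).
Proof.
move=> t0 v; rewrite leNgt; apply/negP => fv.
have v0 : v != 0 by apply: contraTneq fv => ->; rewrite mulmx0 hs0r ltxx.
(* Makes the barrier correction at [v] equal to the assumed deficit times [hs v v / (hs v v + 1)],
   hence too small to compensate it. *)
pose eps := - hs v (f t *m v) / (expR (c * t) * (hs v v + 1)).
have p0 : 0 < expR (c * t) * (hs v v + 1) by rewrite mulr_gt0 ?expR_gt0 // ltr_wpDl ?hs_ge0.
have eps0 : 0 < eps by rewrite divr_gt0 // oppr_gt0.
have := barrier_pos eps0 t0 v0.
rewrite /barrier mulmxDl hsDr -scalemxAl mul1mx hsZr ltNge => /negP; apply.
have -> : eps * expR (c * t) * hs v v = - hs v (f t *m v) * (hs v v / (hs v v + 1)).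
  rewrite /eps; have := expR_gt0 (c * t); have := hs_ge0 v.
  move: (expR _) (hs v v) (hs v _) => p q r q0 p1.
  by field; rewrite !gt_eqF // ltr_wpDl.
rewrite mulNr subr_le0 ler_nMr // ler_pdivrMr ?ltr_wpDl ?hs_ge0 //.
by rewrite mul1r lerDl.
Qed.

End Barrier.

(** * The unitary stabiliser of a closed set *)

Section UnitaryNorm.
Context {R : realType} {N : nat}.
Implicit Types (U V W P Q : 'M[R[i]]_N).

Lemma unitary_mulVm U : U \is unitarymx -> U^t* *m U = 1%:M.
Proof. by move=> /unitarymxP /mulmx1C. Qed.

Lemma unitary_mulmV U : U \is unitarymx -> U *m U^t* = 1%:M.
Proof. by move=> /unitarymxP. Qed.

Lemma unitary1 : (1%:M : 'M[R[i]]_N) \is unitarymx.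
Proof. by apply/unitarymxP; rewrite adj1 mulmx1. Qed.

Lemma unitary_adj U : U \is unitarymx -> U^t* \is unitarymx.
Proof. by rewrite trmxC_unitary. Qed.

Lemma unitaryM U V : U \is unitarymx -> V \is unitarymx -> U *m V \is unitarymx.
Proof.
move=> hU hV; apply/unitarymxP.
by rewrite adjM mulmxA -(mulmxA U) unitary_mulmV // mulmx1 unitary_mulmV.
Qed.

(** A crude bound for the entrywise norm of a unitary: its square is at most [N ^ 2 * N], which is
    below [N ^ 4]. *)
Definition unorm : R := (N * N)%:R.

Lemma mnorm_unitary U : U \is unitarymx -> mnorm U <= unorm.
Proof.
move=> /unitary_mulVm hU; rewrite -(@ler_pXn2r _ 2) ?nnegrE ?mnorm_ge0 //.
rewrite (le_trans (mnorm_sqr_le _)) // /hs hU mxtrace1 expr2.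
have -> : complex.Re (N%:R : R[i]) = N%:R by rewrite raddfMn.
by rewrite ler_wpM2l // ler_nat; case: N => // n; rewrite leq_pmulr.
Qed.

Definition mxpow U k : 'M[R[i]]_N := iter k (mulmx U) 1%:M.

Lemma mxpowD U k l : mxpow U (k + l) = mxpow U k *m mxpow U l.
Proof. by elim: k => [|k ih]; rewrite ?mul1mx // addSn /= ih mulmxA. Qed.

Lemma mxpowSr U k : mxpow U k.+1 = mxpow U k *m U.
Proof. by rewrite -addn1 mxpowD /= mulmx1. Qed.

Lemma unitary_mxpow U k : U \is unitarymx -> mxpow U k \is unitarymx.
Proof. by move=> hU; elim: k => [|k ih]; [exact: unitary1 | exact: unitaryM]. Qed.

(* Telescoping between unitaries, so the error grows only linearly in [k]. *)
Lemma mnorm_mxpowB U W k : U \is unitarymx -> W \is unitarymx ->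
  mnorm (mxpow U k - mxpow W k) <= k%:R * (unorm * unorm * mnorm (U - W)).
Proof.
move=> hU hW; have h P : P \is unitarymx ->
    mnorm (P *m (mxpow U k - mxpow W k)) <= k%:R * (unorm * unorm * mnorm (U - W)).
  elim: k P => [|k ih] P hP; first by rewrite subrr mulmx0 mnorm0 mul0r.
  have -> : P *m (mxpow U k.+1 - mxpow W k.+1) =
      P *m (U - W) *m mxpow U k + P *m W *m (mxpow U k - mxpow W k).
    by rewrite /= !mulmxBr !mulmxBl !mulmxA addrA subrK.
  rewrite (le_trans (mnormD _ _)) // -natr1 mulrDl mul1r addrC lerD //.
    by apply: ih; exact: unitaryM.
  rewrite (le_trans (mnormM _ _)) // mulrAC ler_pM ?mnorm_ge0 //.
    rewrite (le_trans (mnormM _ _)) // ler_wpM2r ?mnorm_ge0 //; exact: mnorm_unitary.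
  by apply: mnorm_unitary; exact: unitary_mxpow.
by have := h 1%:M unitary1; rewrite mul1mx.
Qed.

Definition conjU U X : 'M[R[i]]_N := U *m X *m U^t*.

Lemma mnorm_conjUB U V X :
  mnorm (conjU U X - conjU V X) <= mnorm (U - V) * (mnorm X * (mnorm U + mnorm V)).
Proof.
have -> : conjU U X - conjU V X = (U - V) *m X *m U^t* + V *m X *m (U - V)^t*.
  by rewrite /conjU adjB !mulmxBl !mulmxBr addrA subrK.
rewrite (le_trans (mnormD _ _)) // !mulrDr lerD //.
  rewrite (le_trans (mnormM _ _)) // mnorm_adj mulrA ler_wpM2r ?mnorm_ge0 //.
  exact: mnormM.
rewrite (le_trans (mnormM _ _)) // mnorm_adj mulrC ler_wpM2l ?mnorm_ge0 //.
by rewrite mulrC mnormM.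
Qed.

Lemma mnorm_conjU U X : U \is unitarymx -> mnorm (conjU U X) <= unorm * unorm * mnorm X.
Proof.
move=> hU; rewrite (le_trans (mnormM _ _)) // mnorm_adj mulrAC.
rewrite ler_pM ?mnorm_ge0 ?mnorm_unitary //.
by rewrite (le_trans (mnormM _ _)) // ler_wpM2r ?mnorm_ge0 ?mnorm_unitary.
Qed.

Lemma conjU_conjU U V X : conjU U (conjU V X) = conjU (U *m V) X.
Proof. by rewrite /conjU adjM !mulmxA. Qed.

End UnitaryNorm.
Arguments unorm {R N}.

Section Stabilizer.
Context {R : realType} {N : nat}.
Implicit Types (U V W X Y : 'M[R[i]]_N).
Local Notation B := (@unorm R N).

Definition mclosed (K : 'M[R[i]]_N -> Prop) : Prop :=
  forall X, (forall eps, 0 < eps -> exists2 Y, K Y & mnorm (Y - X) < eps) -> K X.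

Variable K : 'M[R[i]]_N -> Prop.
Hypothesis K_closed : mclosed K.

Definition stab U : Prop := U \is unitarymx /\ forall X, K X -> K (conjU U X).

Lemma stab1 : stab 1%:M.
Proof. by split=> [|X]; [exact: unitary1 | rewrite /conjU adj1 mulmx1 mul1mx]. Qed.

Lemma stabM U V : stab U -> stab V -> stab (U *m V).
Proof.
move=> [hU kU] [hV kV]; split; first exact: unitaryM.
by move=> X /kV /kU; rewrite conjU_conjU.
Qed.

Lemma stab_mxpow U k : stab U -> stab (mxpow U k).
Proof. by move=> hU; elim: k => [|k ih]; [exact: stab1 | exact: stabM]. Qed.

(** Unitarity and the conjugation action are both quadratic in [U], so replacing [U] by a nearby
    stabilising [V] costs [mnorm (U - V)] times a constant; closedness of [K] absorbs the limit. *)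
Lemma stab_closed : mclosed stab.
Proof.
move=> U hU.
have unorm0 : 0 <= B by exact: ler0n.
have B0 : 0 < 2 * B + 1 by rewrite ltr_wpDl // mulr_ge0.
have mU : mnorm U <= B + 1.
  have [V [uV _] VU] := hU _ ltr01; have := mnorm_triangle V U 0.
  rewrite !subr0 mnorm_distC => /le_trans; apply; rewrite addrC lerD ?(ltW VU) //.
  exact: mnorm_unitary.
have mUV V : stab V -> mnorm U + mnorm V <= 2 * B + 1.
  move=> [/mnorm_unitary uV _]; apply: (le_trans (lerD mU uV)).
  by rewrite addrAC mulr_natl mulr2n.
split.
  apply/unitarymxP/eqP; rewrite -subr_eq0; apply/eqP/mnorm_eq0 => eps eps0.
  have e0 : 0 < eps / (2 * B + 1) by rewrite divr_gt0.
  have [V sV VU] := hU _ e0.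
  rewrite -(unitary_mulmV sV.1).
  have -> : U *m U^t* - V *m V^t* = (U - V) *m U^t* + V *m (U - V)^t*.
    by rewrite adjB mulmxBl mulmxBr addrA subrK.
  rewrite (le_lt_trans (mnormD _ _)) //.
  apply: (@le_lt_trans _ _ (mnorm (U - V) * (mnorm U + mnorm V))).
    rewrite mulrDr lerD // (le_trans (mnormM _ _)) // mnorm_adj //.
    by rewrite mulrC.
  apply: (@le_lt_trans _ _ (mnorm (U - V) * (2 * B + 1))).
    by rewrite ler_wpM2l ?mnorm_ge0 ?mUV.
  by rewrite -ltr_pdivlMr // mnorm_distC.
move=> X kX; apply: K_closed => eps eps0.
pose M := mnorm X * (2 * B + 1) + 1.
have M0 : 0 < M by rewrite ltr_wpDl // mulr_ge0 ?mnorm_ge0 ?ltW.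
have e0 : 0 < eps / M by rewrite divr_gt0.
have [V sV VU] := hU _ e0.
exists (conjU V X); first exact: sV.2.
rewrite (le_lt_trans (mnorm_conjUB _ _ _)) //.
apply: (@le_lt_trans _ _ (mnorm (V - U) * M)); last by rewrite -ltr_pdivlMr.
apply: ler_wpM2l; first exact: mnorm_ge0.
by rewrite /M (addrC (mnorm V)) ler_wpDr // ler_wpM2l ?mnorm_ge0 ?mUV.
Qed.

(* In a compact group the powers of [U] come back close to [1], hence [U^-1] is a limit of
   nonnegative powers. *)
Lemma stab_adj U : stab U -> stab (U^t*).
Proof.
move=> sU; have uU := sU.1; apply: stab_closed => eps eps0.
have [|A hA] := @mnorm_cluster R _ _ (mxpow U) B.
  by move=> k; exact/mnorm_unitary/unitary_mxpow.
have B0 : 0 < B * 2 + 1 by rewrite ltr_wpDl // mulr_ge0 // ler0n.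
have e0 : 0 < eps / (B * 2 + 1) by rewrite divr_gt0.
have [k _ hk] := hA _ e0 0%N; have [l kl hl] := hA _ e0 k.+1.
(* [U ^ j] differs from the inverse of [U] by [U ^ (- k - 1)] times [U ^ l - U ^ k], which is small
   because both powers are near the cluster point. The choice [l >= k.+1] keeps the exponent
   nonnegative. *)
pose j := (l - k.+1)%N; exists (mxpow U j); first exact: stab_mxpow.
have uk : mxpow U k.+1 \is unitarymx by exact: unitary_mxpow.
have -> : mxpow U j - U^t* = (mxpow U k.+1)^t* *m (mxpow U l - mxpow U k).
  rewrite mulmxBr -[in mxpow U l](subnKC kl) mxpowD mulmxA unitary_mulVm // mul1mx.
  rewrite mxpowSr adjM -mulmxA unitary_mulVm; last exact: unitary_mxpow.
  by rewrite mulmx1.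
rewrite (le_lt_trans (mnormM _ _)) // mnorm_adj.
apply: (@le_lt_trans _ _ (B * (mnorm (mxpow U l - mxpow U k)))).
  by rewrite ler_wpM2r ?mnorm_ge0 ?mnorm_unitary.
have h : mnorm (mxpow U l - mxpow U k) <= 2 * (eps / (B * 2 + 1)).
  apply: le_trans (mnorm_triangle A _ _) _; rewrite mulr_natl mulr2n.
  by rewrite [mnorm (A - _)]mnorm_distC ltW // ltrD.
apply: (@le_lt_trans _ _ (B * (2 * (eps / (B * 2 + 1))))).
  by rewrite ler_wpM2l // ler0n.
rewrite !mulrA ltr_pdivrMr // mulrC ltr_pM2l //.
by rewrite mulrC ltrDl.
Qed.

(** Only a first-order approximant in the stabiliser is asked for at each small positive [t], chosen
    independently for each [t]. No regularity in [t] has to be maintained, which allows the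
    substitution of [sqrt t] in the commutator argument. Antihermiticity is carried along so that
    adjoints of approximants of [X] approximate [- X]. *)
Definition tangent X : Prop := X^t* = - X /\
  forall eps : R, 0 < eps -> exists2 delta, 0 < delta & forall t, 0 < t -> t < delta ->
    exists2 U, stab U & mnorm (U - 1%:M - t%:C *: X) <= eps * t.

Lemma tangent_curve (W : R -> 'M[R[i]]_N) X : X^t* = - X -> W 0 = 1%:M -> mderiv W 0 X ->
  (forall t, 0 < t -> stab (W t)) -> tangent X.
Proof.
move=> hX W0 /mderiv_littleo dW sW; split=> // eps /dW [delta d0 hd].
exists delta => // t t0 td; exists (W t); first exact: sW.
by have := hd t; rewrite gtr0_norm // add0r W0; apply.
Qed.

Lemma tangent0 : tangent 0.
Proof.
apply: (tangent_curve (W := fun=> 1%:M)) => //.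
- by rewrite trmx0 map_mx0 oppr0.
- exact: mderiv_cst.
- by move=> t _; exact: stab1.
Qed.

Lemma tangentN X : tangent X -> tangent (- X).
Proof.
move=> [hX tX]; split; first by rewrite adjN hX.
move=> eps /tX [delta d0 hd]; exists delta => // t t0 /(hd _ t0) [U sU hU].
exists (U^t*); first exact: stab_adj.
rewrite -mnorm_adj adjB adjB trmxCK adj1 adjZ conjC_real adjN hX opprK.
exact: hU.
Qed.

Lemma tangentZ_gt0 (r : R) X : 0 < r -> tangent X -> tangent (r%:C *: X).
Proof.
move=> r0 [hX tX]; split; first by rewrite adjZ conjC_real hX scalerN.
move=> eps eps0; have [|delta d0 hd] := tX (eps / r); first by rewrite divr_gt0.
exists (delta / r) => [|t t0]; first by rewrite divr_gt0.
rewrite ltr_pdivlMr // => tr; have [|U sU hU] := hd (t * r) _ tr.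
  by rewrite mulr_gt0.
exists U => //; rewrite scalerA -rmorphM /=.
by rewrite (_ : eps * t = eps / r * (t * r)) // mulrACA mulVf ?gt_eqF // mulr1.
Qed.

Lemma tangentZ (r : R) X : tangent X -> tangent (r%:C *: X).
Proof.
move=> tX; have [r0|r0|->] := ltgtP r 0; last by rewrite scale0r; exact: tangent0.
  rewrite -[r]opprK rmorphN scaleNr -scalerN; apply: tangentZ_gt0; last exact: tangentN.
  by rewrite oppr_gt0.
exact: tangentZ_gt0.
Qed.

Lemma tangent_pair X Y eps : tangent X -> tangent Y -> 0 < eps ->
  exists2 delta, 0 < delta & forall t, 0 < t -> t < delta ->
    exists U V, [/\ stab U, stab V, mnorm (U - 1%:M - t%:C *: X) <= eps * t &
                    mnorm (V - 1%:M - t%:C *: Y) <= eps * t].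
Proof.
move=> [_ tX] [_ tY] eps0; have [d1 d10 h1] := tX _ eps0; have [d2 d20 h2] := tY _ eps0.
have [h [h0 hd1 hd2]] := ex_lt_both d10 d20; exists h => // t t0 th.
have [U sU hU] := h1 t t0 (lt_trans th hd1).
have [V sV hV] := h2 t t0 (lt_trans th hd2).
by exists U, V.
Qed.

Lemma mnorm_near_le X (U : 'M[R[i]]_N) (e t : R) : 0 <= t ->
  mnorm (U - 1%:M - t%:C *: X) <= e * t -> mnorm (U - 1%:M) <= (mnorm X + e) * t.
Proof.
move=> t0 h; rewrite -(subrK (t%:C *: X) (U - 1%:M)) (le_trans (mnormD _ _)) //.
by rewrite mnormZ cnorm_real ger0_norm // mulrDl addrC lerD // mulrC.
Qed.

Lemma mulmxB1 (U V : 'M[R[i]]_N) :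
  U *m V - 1%:M = (U - 1%:M) *m (V - 1%:M) + ((U - 1%:M) + (V - 1%:M)).
Proof.
rewrite -{1}(subrK 1%:M U) -{1}(subrK 1%:M V); move: (U - _) (V - _) => a b.
by rewrite mulmxDl !mulmxDr !mulmx1 !mul1mx !addrA addrK.
Qed.

Lemma tangentD X Y : tangent X -> tangent Y -> tangent (X + Y).
Proof.
move=> tX tY; split; first by rewrite adjD tX.1 tY.1 opprD.
move=> eps eps0; have e0 : 0 < eps / 3 by rewrite divr_gt0.
have [d d0 hd] := tangent_pair tX tY e0.
(* [M * t ^ 2] bounds the cross term [(U - 1) (V - 1)]; it receives one third of the error budget,
   and the two linear remainders receive the others. *)
pose M := (mnorm X + eps / 3) * (mnorm Y + eps / 3).
have M0 : 0 < M by rewrite mulr_gt0 // ltr_wpDl ?mnorm_ge0.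
have eM : 0 < eps / 3 / M by rewrite divr_gt0.
have [h [h0 hd1 hM]] := ex_lt_both d0 eM; exists h => // t t0 th.
have [U [V [sU sV hU hV]]] := hd t t0 (lt_trans th hd1).
exists (U *m V); first exact: stabM.
have -> : U *m V - 1%:M - t%:C *: (X + Y) = (U - 1%:M) *m (V - 1%:M) +
    ((U - 1%:M - t%:C *: X) + (V - 1%:M - t%:C *: Y)).
  by rewrite mulmxB1 scalerDr opprD -addrA; congr (_ + _); exact: addrACA.
rewrite (le_trans (mnormD _ _)) //.
have h1 : mnorm ((U - 1%:M) *m (V - 1%:M)) <= eps / 3 * t.
  rewrite (le_trans (mnormM _ _)) //.
  apply: (@le_trans _ _ ((mnorm X + eps / 3) * t * ((mnorm Y + eps / 3) * t))).
    have := (mnorm_near_le (ltW t0) hU, mnorm_near_le (ltW t0) hV) => -[? ?].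
    by apply: ler_pM => //; exact: mnorm_ge0.
  rewrite mulrACA -/M mulrA ler_wpM2r ?ltW // mulrC -ltr_pdivlMr //.
  exact: lt_trans th hM.
have h2 := le_trans (mnormD (U - 1%:M - t%:C *: X) (V - 1%:M - t%:C *: Y)) (lerD hU hV).
have -> : eps * t = eps / 3 * t + (eps / 3 * t + eps / 3 * t) by field.
exact: lerD.
Qed.

Lemma comm_near_le X Y (P Q : 'M[R[i]]_N) (e s : R) : 0 <= s -> 0 <= e ->
  mnorm (P - s%:C *: X) <= e * s -> mnorm (Q - s%:C *: Y) <= e * s ->
  mnorm (P *m Q - Q *m P - (s ^+ 2)%:C *: q_comm X Y) <=
    2 * (e * (mnorm X + mnorm Y + e)) * s ^+ 2.
Proof.
move=> s0 e0; set a := P - _; set b := Q - _ => ha hb.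
have prod_le A D (C E : 'M[R[i]]_N) : mnorm C <= A * s -> mnorm E <= D * s ->
    0 <= A -> 0 <= D -> mnorm (C *m E) <= A * D * s ^+ 2.
  move=> hC hE A0 D0; rewrite (le_trans (mnormM _ _)) // expr2 mulrACA.
  by rewrite ler_pM ?mnorm_ge0.
have sX (Z : 'M[R[i]]_N) : mnorm (s%:C *: Z) <= mnorm Z * s.
  by rewrite mnormZ cnorm_real ger0_norm // mulrC.
have half (Z W c d : 'M[R[i]]_N) : mnorm c <= e * s -> mnorm d <= e * s ->
    mnorm ((s%:C *: Z + c) *m (s%:C *: W + d) - (s ^+ 2)%:C *: (Z *m W)) <=
      e * (mnorm Z + mnorm W + e) * s ^+ 2.
  move=> hc hd.
  have -> : (s%:C *: Z + c) *m (s%:C *: W + d) - (s ^+ 2)%:C *: (Z *m W) =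
      (s%:C *: Z) *m d + (c *m (s%:C *: W) + c *m d).
    have E : (s%:C *: Z) *m (s%:C *: W) = (s ^+ 2)%:C *: (Z *m W).
      by rewrite -scalemxAr -scalemxAl scalerA -rmorphM.
    by rewrite mulmxDl !mulmxDr E -(addrA (_ *: (Z *m W))) [LHS]addrC addKr.
  rewrite (le_trans (mnormD _ _)) //.
  have h1 := prod_le _ _ _ _ (sX Z) hd (mnorm_ge0 _) e0.
  have h2 := prod_le _ _ _ _ hc (sX W) e0 (mnorm_ge0 _).
  have h3 := prod_le _ _ _ _ hc hd e0 e0.
  apply: le_trans (lerD h1 (le_trans (mnormD _ _) (lerD h2 h3))) _.
  by rewrite le_eqVlt; apply/orP; left; apply/eqP; ring.
have -> : P *m Q - Q *m P - (s ^+ 2)%:C *: q_comm X Y =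
    ((s%:C *: X + a) *m (s%:C *: Y + b) - (s ^+ 2)%:C *: (X *m Y)) -
    ((s%:C *: Y + b) *m (s%:C *: X + a) - (s ^+ 2)%:C *: (Y *m X)).
  have key (u v w z : 'M[R[i]]_N) : u - v - (w - z) = (u - w) - (v - z).
    by rewrite !opprB [LHS]addrACA [RHS]addrACA (addrC (- v)).
  by rewrite /a /b ![_%:C *: _ + _]addrC !subrK /q_comm scalerBr key.
rewrite (le_trans (mnormD _ _)) // mnormN.
apply: le_trans (lerD (half X Y _ _ ha hb) (half Y X _ _ hb ha)) _.
by rewrite le_eqVlt; apply/orP; left; apply/eqP; ring.
Qed.

Lemma comm_mxB1 (U V : 'M[R[i]]_N) :
  (U - 1%:M) *m (V - 1%:M) - (V - 1%:M) *m (U - 1%:M) = U *m V - V *m U.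
Proof.
have E (P Q : 'M[R[i]]_N) :
    P *m Q = (P - 1%:M) *m (Q - 1%:M) + ((P - 1%:M) + (Q - 1%:M) + 1%:M).
  by rewrite addrA -mulmxB1 subrK.
rewrite (E U V) (E V U) (addrC (V - 1%:M) (U - 1%:M)) opprD addrACA subrr addr0.
by [].
Qed.

Lemma quarter_le (F : realFieldType) (q eps : F) : 4 * q < eps -> 2 * q <= eps / 2.
Proof. lra. Qed.

(** Group commutators at parameter [s = sqrt t]: [U V U^* V^* - 1 = (U V - V U) U^* V^*], with
    leading term [s ^ 2 [X, Y] = t [X, Y]]. The adjoints lie in the stabiliser because it is a
    group. *)
Lemma tangent_comm X Y : tangent X -> tangent Y -> tangent (q_comm X Y).
Proof.
move=> tX tY; split.
  by rewrite /q_comm adjB !adjM tX.1 tY.1 !mulmxN !mulNmx !opprK opprB.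
move=> eps eps0; set S := mnorm X + mnorm Y + 1.
have S1 : 1 <= S by rewrite lerDr addr_ge0 ?mnorm_ge0.
have [e [e0 eS e1]] : exists e, [/\ 0 < e, e < eps / (4 * S) & e < 1].
  by apply: ex_lt_both => //; rewrite divr_gt0 // mulr_gt0 // (lt_le_trans ltr01).
have [d d0 hd] := tangent_pair tX tY e0.
pose x := mnorm X + 1; pose y := mnorm Y + 1.
have x0 : 0 < x by rewrite ltr_wpDl ?mnorm_ge0.
have y0 : 0 < y by rewrite ltr_wpDl ?mnorm_ge0.
(* For [s < 1], [2 x y s ^ 2] bounds [U V - V U] and [(x y + x + y) s] bounds [U^* V^* - 1], so
   [M s ^ 3] bounds the remainder beyond the commutator. *)
pose M := 2 * x * y * (x * y + (x + y)).
have M0 : 0 < M.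
  by apply: mulr_gt0; [apply: mulr_gt0 => //; exact: mulr_gt0 | apply: addr_gt0; [exact: mulr_gt0 | exact: addr_gt0]].
have [h1 [h10 h1d h11]] := ex_lt_both d0 (ltr01 : 0 < 1 :> R).
have eM : 0 < eps / 2 / M by rewrite !divr_gt0.
have [h [h0 hh1 hM]] := ex_lt_both h10 eM.
exists (h ^+ 2) => [|t t0 th]; first by rewrite exprn_gt0.
pose s := Num.sqrt t; have s0 : 0 < s by rewrite sqrtr_gt0.
have sE : s ^+ 2 = t by rewrite sqr_sqrtr // ltW.
have sh : s < h by rewrite -(@ltr_pXn2r _ 2) ?nnegrE ?(ltW s0) ?(ltW h0) // sE.
have s1 : s < 1 by exact: lt_trans sh (lt_trans hh1 h11).
have [U [V [sU sV hU hV]]] := hd s s0 (lt_trans sh (lt_trans hh1 h1d)).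
have [sU' sV'] := (stab_adj sU, stab_adj sV).
exists (U *m V *m (U^t* *m V^t*)); first by apply: stabM; exact: stabM.
set P := U - 1%:M; set Q := V - 1%:M; set C := P *m Q - Q *m P.
have le1 (Z W : 'M[R[i]]_N) : mnorm (W - 1%:M - s%:C *: Z) <= e * s ->
    mnorm (W - 1%:M) <= (mnorm Z + 1) * s.
  move=> /(mnorm_near_le (ltW s0)) /le_trans; apply.
  by rewrite ler_wpM2r ?(ltW s0) // lerD2l ltW.
have hP : mnorm P <= x * s by exact: le1 hU.
have hQ : mnorm Q <= y * s by exact: le1 hV.
have CE : U *m V *m (U^t* *m V^t*) - 1%:M = C + C *m (U^t* *m V^t* - 1%:M).
  rewrite /C comm_mxB1.
  have key (A D : 'M[R[i]]_N) : A + A *m (D - 1%:M) = A *m D.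
    by rewrite mulmxBr mulmx1 addrC subrK.
  rewrite key mulmxBl; congr (_ - _).
  by rewrite mulmxA -(mulmxA V) (unitary_mulmV sU.1) mulmx1 (unitary_mulmV sV.1).
have hC : mnorm C <= 2 * x * y * s ^+ 2.
  rewrite (le_trans (mnormD _ _)) // mnormN.
  have -> : 2 * x * y * s ^+ 2 = (x * s) * (y * s) + (y * s) * (x * s) by ring.
  by apply: lerD; rewrite (le_trans (mnormM _ _)) // ler_pM ?mnorm_ge0.
have hUV : mnorm (U^t* *m V^t* - 1%:M) <= (x * y + (x + y)) * s.
  rewrite mulmxB1 (le_trans (mnormD _ _)) //.
  have -> : U^t* - 1%:M = P^t* by rewrite adjB adj1.
  have -> : V^t* - 1%:M = Q^t* by rewrite adjB adj1.
  rewrite mulrDl; apply: lerD; last first.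
    by rewrite (le_trans (mnormD _ _)) // !mnorm_adj mulrDl lerD.
  rewrite (le_trans (mnormM _ _)) // !mnorm_adj.
  apply: (@le_trans _ _ ((x * s) * (y * s))); first by rewrite ler_pM ?mnorm_ge0.
  rewrite mulrACA ler_wpM2l ?mulr_ge0 ?ltW // -[ltRHS]mulr1 ltr_pM2l //.
rewrite CE addrAC (le_trans (mnormD _ _)) // -sE.
have -> : eps * s ^+ 2 = eps / 2 * s ^+ 2 + eps / 2 * s ^+ 2 by field.
apply: lerD.
  apply: le_trans (comm_near_le (ltW s0) (ltW e0) hU hV) _.
  rewrite ler_wpM2r ?sqr_ge0 //.
  apply: (@le_trans _ _ (2 * (e * S))).
    by rewrite !ler_wpM2l ?(ltW e0) // lerD2l ltW.
  apply: quarter_le; rewrite mulrCA -ltr_pdivlMr //.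
  by rewrite mulr_gt0 // (lt_le_trans ltr01).
rewrite (le_trans (mnormM _ _)) //.
apply: (@le_trans _ _ (2 * x * y * s ^+ 2 * ((x * y + (x + y)) * s))).
  by rewrite ler_pM ?mnorm_ge0.
have -> : 2 * x * y * s ^+ 2 * ((x * y + (x + y)) * s) = s * M * s ^+ 2.
  by rewrite /M; ring.
rewrite ler_wpM2r ?sqr_ge0 // -ler_pdivlMr // ltW //.
exact: lt_trans sh hM.
Qed.

Lemma tangent_lie_closed : q_lie_closed tangent.
Proof.
by split; [exact: tangent0 | exact: tangentD | exact: tangentZ | exact: tangent_comm].
Qed.

(* [exp X = lim (1 + X/k + o(1/k))^k] for a one-parameter group [W] with generator [X]. *)
Lemma stab_exp (W : R -> 'M[R[i]]_N) X : tangent X -> W 0 = 1%:M -> mderiv W 0 X ->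
  (forall t, W t \is unitarymx) -> (forall s t, W (s + t) = W s *m W t) -> stab (W 1).
Proof.
move=> [_ tX] W0 dW uW WD; apply: stab_closed => eps eps0.
pose M := B * B * 2 + 1; have M0 : 0 < M by rewrite ltr_wpDl // !mulr_ge0 ?ler0n.
have e0 : 0 < eps / M by rewrite divr_gt0.
have [d1 d10 h1] := tX _ e0; have [d2 d20 h2] := mderiv_littleo dW e0.
have [d [d0 hd1 hd2]] := ex_lt_both d10 d20.
pose k := (Num.trunc d^-1).+1; pose t : R := k%:R^-1.
have t0 : 0 < t by rewrite invr_gt0 ltr0n.
have td : t < d.
  have di : 0 <= d^-1 by rewrite invr_ge0 ltW.
  have /andP[_ hk] := truncn_itv di.
  by rewrite -[ltRHS]invrK ltf_pV2 ?posrE ?invr_gt0 ?ltr0n.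
have [U sU hU] := h1 t t0 (lt_trans td hd1).
have hW : mnorm (W t - 1%:M - t%:C *: X) <= eps / M * t.
  by have := h2 t; rewrite gtr0_norm // add0r W0; apply; exact: lt_trans td hd2.
have UW : mnorm (U - W t) <= 2 * (eps / M * t).
  apply: (le_trans (mnorm_triangle (1%:M + t%:C *: X) _ _)).
  by rewrite [X in _ + X]mnorm_distC !opprD !addrA mulr_natl mulr2n lerD.
have Wk j : mxpow (W t) j = W (j%:R * t).
  by elim: j => [|j ih]; rewrite ?mul0r ?W0 // /= ih -WD -nat1r mulrDl mul1r.
exists (mxpow U k); first exact: stab_mxpow.
have -> : W 1 = mxpow (W t) k by rewrite Wk divff // pnatr_eq0.
apply: (le_lt_trans (mnorm_mxpowB k sU.1 (uW t))).
apply: (@le_lt_trans _ _ (k%:R * (B * B * (2 * (eps / M * t))))).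
  by rewrite ler_wpM2l ?ler0n // ler_wpM2l // mulr_ge0 ?ler0n.
have -> : k%:R * (B * B * (2 * (eps / M * t))) = eps * (B * B * 2) / M.
  have : k%:R * t = 1 by rewrite divff // pnatr_eq0.
  move: (k%:R : R) => q hq; rewrite -[RHS]mul1r -hq.
  by move: (B * B : R) M^-1 => b m; ring.
by rewrite ltr_pdivrMr // ltr_pM2l // ltrDl.
Qed.

End Stabilizer.

(** * Phases and spectral decompositions *)

Section Phases.
Context {R : realType}.

Definition cis (x : R) : R[i] := cos x +i* sin x.

Lemma cis0 : cis 0 = 1.
Proof. by rewrite /cis cos0 sin0. Qed.

Lemma cisD x y : cis (x + y) = cis x * cis y.
Proof. by rewrite /cis cosD sinD; apply/eqP; rewrite eq_complex /= eqxx addrC eqxx. Qed.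

Lemma conj_cis x : Num.conj (cis x) = cis (- x).
Proof. by rewrite /cis cosN sinN. Qed.

Lemma cis_unit x : cis x * Num.conj (cis x) = 1.
Proof. by rewrite conj_cis -cisD subrr cis0. Qed.

Lemma conj_imag (r : R) : Num.conj (r%:C * 'i) = - (r%:C * 'i).
Proof.
by apply/eqP; rewrite eq_complex /= !(mul0r, mulr0, mulr1, subr0, addr0, oppr0) !eqxx.
Qed.

Lemma cderiv_cis (theta : R) : cderiv (fun s => cis (theta * s)) 0 (theta%:C * 'i).
Proof.
have h : is_derive (0 : R) (1 : R) (fun x => theta * x) theta.
  apply: is_derive_congr (is_deriveZ theta (is_derive_id (0 : R) (1 : R))) => //.
  by rewrite /GRing.scale /= mulr1.
split.
  apply: is_derive_congr (is_derive1_comp (is_derive_cos _) h) => //.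
  by rewrite mulr0 sin0 oppr0 mul0r /= !mulr0 mul0r subr0.
apply: is_derive_congr (is_derive1_comp (is_derive_sin _) h) => //.
by rewrite mulr0 cos0 mul1r /= mulr1 mulr0 addr0.
Qed.

(** [acos] reaches only the upper half circle; the sign of the imaginary part decides between the
    angle and its opposite. *)
Lemma cis_surj (z : R[i]) : z * Num.conj z = 1 -> exists theta, z = cis theta.
Proof.
case: z => a b /eqP; rewrite eq_complex /= => /andP[/eqP + _].
rewrite mulrN opprK -!expr2 => ab.
have a1 : -1 <= a <= 1.
  by rewrite -ler_norml -(@ler_pXn2r _ 2) ?nnegrE // expr1n real_normK ?num_real // -ab lerDl sqr_ge0.
have sb : Num.sqrt (1 - a ^+ 2) = `|b|.
  by rewrite -ab addrAC subrr add0r sqrtr_sqr.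
have [b0|b0] := leP 0 b.
  by exists (acos a); rewrite /cis acosK ?in_itv //= sin_acos // sb ger0_norm.
exists (- acos a); rewrite /cis cosN sinN acosK ?in_itv //= sin_acos // sb ltr0_norm //.
by rewrite opprK.
Qed.

End Phases.

Lemma normal_spectral (R : realType) (N : nat) (A : 'M[R[i]]_N) : A \is normalmx ->
  exists (Q : 'M[R[i]]_N) (d : 'rV[R[i]]_N), Q \is unitarymx /\ A = Q^t* *m diag_mx d *m Q.
Proof.
move=> nA; exists (spectralmx A), (spectral_diag A).
have uQ := spectral_unitarymx A; split=> //.
by rewrite -(invmx_unitary uQ); exact/orthomx_spectralP.
Qed.

Lemma unitary_sandwichM (R : realType) (N : nat) (Q A B : 'M[R[i]]_N) : Q \is unitarymx ->
  Q^t* *m A *m Q *m (Q^t* *m B *m Q) = Q^t* *m (A *m B) *m Q.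
Proof. by move=> uQ; rewrite !mulmxA -(mulmxA (Q^t* *m A)) (unitary_mulmV uQ) mulmx1. Qed.

(** * From the special unitary Lie algebra to all unitaries *)

Section FullUnitaryGroup.
Context {R : realType} {N : nat} (K : 'M[R[i]]_N -> Prop).
Hypothesis K_closed : mclosed K.
Local Notation tangent := (tangent K).
Local Notation stab := (stab K).

(** Scalar phases conjugate trivially and so stabilise any [K]. They supply the one antihermitian
    direction that is missing among traceless matrices. *)
Lemma tangent_phase : tangent ('i *: 1%:M).
Proof.
have uW s : (cis s)%:M \is @unitarymx R[i] N N.
  by apply/unitarymxP; rewrite tr_scalar_mx map_scalar_mx -scalar_mxM cis_unit.
apply: (tangent_curve (W := fun s => (cis s)%:M)).
- by rewrite adjZ adj1 conjC_i scaleNr.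
- by rewrite cis0.
- have h := cderiv_cis (1 : R); have E : (1 : R)%:C * 'i = 'i :> R[i] by exact: mul1r.
  rewrite E in h.
  move=> i j; apply: cderiv_congr (cderivM h (cderiv_cst ((i == j)%:R : R[i]) 0)).
    by move=> s; rewrite mul1r mxE mulr_natr.
  by rewrite mulr0 addr0 !mxE.
move=> t _; split=> // X KX.
rewrite /conjU tr_scalar_mx map_scalar_mx mul_scalar_mx mul_mx_scalar scalerA.
by rewrite mulrC cis_unit scale1r.
Qed.

Lemma tangent_antiherm : (0 < N)%N -> (forall X, q_su X -> tangent X) ->
  forall X, X^t* = - X -> tangent X.
Proof.
move=> N0 hsu X hX; have N0' : (N%:R : R) != 0 by rewrite pnatr_eq0 -lt0n.
pose r : R := complex.Im (\tr X) / N%:R.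
have trX : \tr X = (complex.Im (\tr X))%:C * 'i.
  have : complex.Re (\tr X) = 0.
    have := tr_adj X; rewrite hX linearN /=; case: (\tr X) => a b [/eqP].
    by rewrite eq_sym -subr_eq0 opprK -mulr2n mulrn_eq0 => /eqP.
  by case: (\tr X) => a b /= ->; apply/eqP; rewrite eq_complex /= !(mulr0, mul0r, mulr1, subr0, addr0) !eqxx.
have -> : X = (X - r%:C *: ('i *: 1%:M)) + r%:C *: ('i *: 1%:M) by rewrite subrK.
apply: tangentD; last exact/(tangentZ K_closed)/tangent_phase.
apply: hsu; split.
  by rewrite q_adjE adjB hX !adjZ adj1 conjC_real conjC_i opprB scaleNr scalerN opprK addrC.
rewrite raddfB /= !mxtraceZ mxtrace1 {1}trX /r mulrCA.
have -> : (N%:R : R[i]) = (N%:R)%:C by rewrite rmorph_nat.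
by rewrite -rmorphM divfK // mulrC subrr.
Qed.

(** Every unitary is the value at time [1] of a one-parameter group: diagonalise it and choose an
    angle for each eigenvalue. *)
Lemma stab_unitary : (forall X, X^t* = - X -> tangent X) ->
  forall U, U \is unitarymx -> stab U.
Proof.
move=> tall U uU.
have nU : U \is normalmx by apply/normalmxP; rewrite (unitary_mulmV uU) (unitary_mulVm uU).
have [Q [d [uQ UE]]] := normal_spectral nU.
have dE : diag_mx d = Q *m U *m Q^t*.
  by rewrite UE !mulmxA (unitary_mulmV uQ) mul1mx -mulmxA (unitary_mulmV uQ) mulmx1.
have hd k : d 0 k * Num.conj (d 0 k) = 1.
  have : diag_mx d *m (diag_mx d)^t* = 1%:M.
    by apply: unitary_mulmV; rewrite dE; exact: unitaryM (unitaryM uQ uU) (unitary_adj uQ).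
  rewrite adj_diag mulmx_diag => /matrixP/(_ k k).
  by rewrite !mxE eqxx !mulr1n.
have /choice [theta htheta] : forall k, exists x, d 0 k = cis x by move=> k; exact: cis_surj.
pose D (s : R) : 'M[R[i]]_N := diag_mx (\row_k cis (theta k * s)).
pose W s := Q^t* *m D s *m Q.
pose X := Q^t* *m diag_mx (\row_k ((theta k)%:C * 'i)) *m Q.
have -> : U = W 1.
  rewrite /W UE; congr (_ *m _ *m _); rewrite /D; congr diag_mx.
  by apply/rowP => k; rewrite mxE mulr1 -htheta.
have DD s t : D (s + t) = D s *m D t.
  by rewrite /D mulmx_diag; congr diag_mx; apply/rowP => k; rewrite !mxE mulrDr cisD.
have D0 : D 0 = 1%:M.
  rewrite /D -diag_const_mx; congr diag_mx.
  by apply/rowP => k; rewrite !mxE mulr0 cis0.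
have uD s : D s \is unitarymx.
  apply/unitarymxP; rewrite /D adj_diag mulmx_diag -diag_const_mx; congr diag_mx.
  by apply/rowP => k; rewrite !mxE cis_unit.
apply: (stab_exp K_closed (W := W) (X := X)).
- apply: tall; rewrite /X !adjM trmxCK adj_diag mulmxA -mulNmx -mulmxN; congr (_ *m _ *m _).
  rewrite -linearN; congr diag_mx; apply/rowP => k; rewrite !mxE.
  exact: conj_imag.
- by rewrite /W D0 mulmx1 unitary_mulVm.
- apply/mderiv_mulr/mderiv_mull => i j.
  apply: cderiv_congr (cderivM (cderiv_cis (theta j)) (cderiv_cst ((i == j)%:R : R[i]) 0)).
    by move=> s; rewrite !mxE mulr_natr; case: eqP => [->|].
  by rewrite mulr0 addr0 !mxE mulr_natr; case: eqP => [->|].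
- by move=> s; exact: unitaryM (unitaryM (unitary_adj uQ) (uD s)) uQ.
by move=> s t; rewrite /W DD unitary_sandwichM.
Qed.

End FullUnitaryGroup.

(** * Nearest points *)

Lemma half_gap (F : realFieldType) (a d s k : F) :
  a - d <= (a - s) / 2 -> k < (a - s) / 2 -> s + k <= d.
Proof. lra. Qed.

(** Error budget for a first-order gain [t * h]: the approximation error [r1] costs at most half of
    it, the quadratic remainder [r2] less than a quarter. *)
Lemma first_order_gt0 (F : realFieldType) (h t c e x r1 r2 : F) : 0 < h -> 0 < t ->
  1 <= c -> e * c = h / 4 -> t * (4 * c * x ^+ 2) < h ->
  - (2 * (e * t) * (c - 1)) <= r1 -> - ((x * t) ^+ 2 * (c - 1)) <= r2 ->
  0 < t * h + (r1 + r2).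
Proof.
move=> h0 t0 c1 ec tx b1 b2.
have e0 : 0 <= e by rewrite -(pmulr_lge0 _ (lt_le_trans ltr01 c1)) ec; lra.
have h1 : 2 * (e * t) * (c - 1) <= 2 * t * (e * c).
  by rewrite -subr_ge0 (_ : _ - _ = 2 * (e * t)) ?mulr_ge0 ?(ltW t0) //; ring.
have h2 : (x * t) ^+ 2 * (c - 1) <= t * (t * (4 * c * x ^+ 2)) / 4.
  by rewrite -subr_ge0 (_ : _ - _ = (x * t) ^+ 2) ?sqr_ge0 //; field.
have h3 : t * (t * (4 * c * x ^+ 2)) < t * h by rewrite ltr_pM2l.
have h4 : 0 < t * h by rewrite mulr_gt0.
rewrite ec in h1; lra.
Qed.

Section Minimiser.
Context {R : realType} {N : nat}.
Implicit Types (X Y rho sigma U : 'M[R[i]]_N).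

Definition dist2 X Y : R := hs (X - Y) (X - Y).

Lemma dist2_ge0 X Y : 0 <= dist2 X Y.
Proof. exact: hs_ge0. Qed.

Lemma dist2_subl A X Y :
  dist2 A Y - dist2 X Y = - (hs (X - A) (X - Y) + hs (A - Y) (X - A)).
Proof.
rewrite /dist2; have -> : X - Y = (X - A) + (A - Y) by rewrite addrA subrK.
move: (X - A) (A - Y) => C D; rewrite !hsDr !hsDl.
by move: (hs _ _) (hs _ _) (hs _ _) (hs _ _) => a b c d; ring.
Qed.

Lemma exists_nearest (K : 'M[R[i]]_N -> Prop) b sigma :
  mclosed K -> (forall X, K X -> mnorm X <= b) -> (exists X, K X) ->
  exists rho, K rho /\ forall X, K X -> dist2 rho sigma <= dist2 X sigma.
Proof.
move=> K_closed Kb [X0 KX0].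
pose S := [set r | exists2 X, K X & r = dist2 X sigma]%classic.
have infS : has_inf S.
  split; first by exists (dist2 X0 sigma), X0.
  by exists 0 => _ [X _ ->]; exact: dist2_ge0.
have /choice [u hu] : forall k : nat, exists X, K X /\ dist2 X sigma < inf S + k.+1%:R^-1.
  move=> k; have k0 : 0 < k.+1%:R^-1 :> R by rewrite invr_gt0.
  by have [_ [X KX ->] h] := inf_adherent k0 infS; exists X.
have [|A hA] := @mnorm_cluster R _ _ u b; first by move=> k; apply: Kb; case: (hu k).
exists A; split.
  by apply: K_closed => eps eps0; have [k _ hk] := hA _ eps0 0%N; exists (u k) => //; case: (hu k).
move=> X KX; have : inf S <= dist2 X sigma by apply: ge_inf; [case: infS | exists X].
apply: le_trans; rewrite leNgt; apply/negP => lt.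
set e := dist2 A sigma - inf S.
have e0 : 0 < e by rewrite subr_gt0.
have e2 : 0 < e / 2 by rewrite divr_gt0.
pose M := (b + mnorm sigma) + mnorm (A - sigma) + 1.
have b0 : 0 <= b by exact: le_trans (mnorm_ge0 _) (Kb _ KX0).
have M0 : 0 < M by rewrite ltr_wpDl // !addr_ge0 ?mnorm_ge0.
have eM : 0 < e / 2 / M by rewrite divr_gt0.
have [k Kk hk] := hA _ eM (Num.trunc (e / 2)^-1).
have [Kuk] := hu k; apply/negP; rewrite -leNgt.
have k1 : k.+1%:R^-1 < e / 2.
  have di : 0 <= (e / 2)^-1 by rewrite invr_ge0 ltW.
  have /andP[_ h] := truncn_itv di.
  rewrite -[ltRHS]invrK ltf_pV2 ?posrE ?invr_gt0 ?ltr0n //.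
  by apply: lt_le_trans h _; rewrite ler_nat ltnS.
have hd : dist2 A sigma - dist2 (u k) sigma <= e / 2.
  rewrite dist2_subl (le_trans (ler_norm _)) // normrN (le_trans (ler_normD _ _)) //.
  apply: (@le_trans _ _ (mnorm (u k - A) * M)); last by rewrite -ler_pdivlMr // ltW.
  rewrite /M -addrA mulrDr lerD //.
    rewrite (le_trans (abs_hs_le _ _)) // ler_wpM2l ?mnorm_ge0 //.
    by rewrite (le_trans (mnormD _ _)) // mnormN lerD2r; exact: Kb.
  rewrite (le_trans (abs_hs_le _ _)) // mulrC ler_wpM2l ?mnorm_ge0 // lerDl //.
exact: half_gap hd k1.
Qed.

Lemma hs_conjU U X Y : U \is unitarymx -> hs (conjU U X) (conjU U Y) = hs X Y.
Proof.
move=> uU; rewrite /conjU /hs !adjM trmxCK -!mulmxA [in LHS]mxtrace_mulC -!mulmxA.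
by rewrite !(mulmxA (U^t*) U) (unitary_mulVm uU) !mul1mx mulmx1.
Qed.

Lemma dist2_conjU U X Y : U \is unitarymx -> dist2 (conjU U X) (conjU U Y) = dist2 X Y.
Proof.
move=> uU; rewrite /dist2.
have -> : conjU U X - conjU U Y = conjU U (X - Y) by rewrite /conjU mulmxBr mulmxBl.
exact: hs_conjU.
Qed.

(** By cyclicity of the trace, [- [rho, sigma]] is the gradient of the overlap with [sigma] along
    the unitary orbit of [rho], so the derivative in that direction is its squared norm. *)
Lemma hs_commutator_swap (rho sigma Z : 'M[R[i]]_N) :
  rho^t* = rho -> sigma^t* = sigma -> Z = q_comm rho sigma ->
  Z^t* = - Z /\ hs ((- Z) *m rho + rho *m (- Z)^t*) sigma = hs Z Z.
Proof.
move=> hr hsg ZE; have hZ : Z^t* = - Z by rewrite ZE /q_comm adjB !adjM hr hsg opprB.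
split=> //; rewrite adjN hZ opprK [LHS]hsC /hs hsg hZ mulNmx.
have t1 : \tr (sigma *m (Z *m rho)) = \tr (Z *m (rho *m sigma)).
  by rewrite mulmxA [LHS]mxtrace_mulC (mulmxA rho) [LHS]mxtrace_mulC.
have t2 : \tr (sigma *m (rho *m Z)) = \tr (Z *m (sigma *m rho)).
  by rewrite (mulmxA sigma) [LHS]mxtrace_mulC.
have t3 : \tr (Z *m Z) = \tr (Z *m (rho *m sigma)) - \tr (Z *m (sigma *m rho)).
  by rewrite -raddfB /= -mulmxBr -/(q_comm rho sigma) -ZE.
have reN (z : R[i]) : - complex.Re z = complex.Re (- z) by case: z.
by rewrite mulNmx mulmxDr mulmxN raddfD !raddfN /= t1 t2 t3 reN opprB addrC.
Qed.

Lemma sandwich_sub1 (U V rho : 'M[R[i]]_N) :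
  U *m rho *m V - rho = ((U - 1%:M) *m rho + rho *m (V - 1%:M)) + (U - 1%:M) *m rho *m (V - 1%:M).
Proof.
rewrite -{1}(subrK 1%:M U) -{1}(subrK 1%:M V); move: (U - _) (V - _) => a b.
rewrite mulmxDl mul1mx mulmxDr mulmx1 mulmxDl addrA addrK [LHS]addrC.
by rewrite [_ + rho *m b]addrC addrA.
Qed.

(* At the nearest point the derivative of the distance along every unitary orbit direction
   vanishes; the direction [- [rho, sigma]] yields [|[rho, sigma]|^2 = 0]. *)
Lemma nearest_comm (K : 'M[R[i]]_N -> Prop) rho sigma :
  (forall X, X^t* = - X -> tangent K X) ->
  rho^t* = rho -> sigma^t* = sigma -> K rho ->
  (forall X, K X -> dist2 rho sigma <= dist2 X sigma) -> q_comm rho sigma = 0.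
Proof.
move=> tall hr hsg Krho near; set Z := q_comm rho sigma.
have [hZ hsZ] := hs_commutator_swap hr hsg (erefl Z).
have [_ tX] : tangent K (- Z) by apply: tall; rewrite adjN hZ opprK.
apply: hs_eq0; apply/eqP; rewrite eq_le hs_ge0 andbT leNgt; apply/negP => h0.
set h := hs Z Z in h0 hsZ; set X := - Z in tX hsZ.
pose c := mnorm rho * mnorm sigma + 1.
have c0 : 0 < c by rewrite ltr_wpDl // mulr_ge0 ?mnorm_ge0.
pose e := h / (4 * c); have e0 : 0 < e by rewrite divr_gt0 // mulr_gt0.
have [d d0 hd] := tX _ e0.
pose x := mnorm X + e; have x0 : 0 < x by rewrite ltr_wpDl ?mnorm_ge0.
have dx : 0 < h / (4 * c * x ^+ 2) by rewrite divr_gt0 // !mulr_gt0 // exprn_gt0.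
have [t [t0 td tx]] := ex_lt_both d0 dx.
have [U [uU kU] hU] := hd t t0 td.
set E := U - 1%:M - t%:C *: X in hU.
have Ux : mnorm (U - 1%:M) <= x * t by exact: mnorm_near_le (ltW t0) hU.
(* Conjugation preserves the norm of [rho], so minimal distance to [sigma] means maximal overlap
   along the orbit. *)
have le_hs : hs (conjU U rho - rho) sigma <= 0.
  have := near _ (kU _ Krho); rewrite /dist2.
  rewrite !hsBr !hsBl hs_conjU // [hs sigma rho]hsC [hs sigma (conjU U rho)]hsC.
  by move: (hs rho rho) (hs rho sigma) (hs _ sigma) (hs sigma sigma) => ? ? ? ?; lra.
have dE : conjU U rho - rho = t%:C *: (X *m rho + rho *m X^t*) +
    ((E *m rho + rho *m E^t*) + (U - 1%:M) *m rho *m (U - 1%:M)^t*).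
  have EU : U - 1%:M = t%:C *: X + E by rewrite /E [RHS]addrC subrK.
  have -> : conjU U rho - rho = ((U - 1%:M) *m rho + rho *m (U - 1%:M)^t*) +
      (U - 1%:M) *m rho *m (U - 1%:M)^t*.
    by rewrite adjB adj1; exact: sandwich_sub1.
  rewrite addrA; congr (_ + _); rewrite EU adjD adjZ conjC_real.
  by rewrite mulmxDl mulmxDr -scalemxAl -scalemxAr addrACA scalerDr.
have b1 : `|hs (E *m rho + rho *m E^t*) sigma| <= 2 * (e * t) * (c - 1).
  rewrite (le_trans (abs_hs_le _ _)) // /c addrK mulrA ler_wpM2r ?mnorm_ge0 //.
  rewrite (le_trans (mnormD _ _)) // [2 * _]mulr_natl mulr2n mulrDl lerD //.
    by rewrite (le_trans (mnormM _ _)) // ler_wpM2r ?mnorm_ge0.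
  by rewrite (le_trans (mnormM _ _)) // mnorm_adj mulrC ler_wpM2r ?mnorm_ge0.
have b2 : `|hs ((U - 1%:M) *m rho *m (U - 1%:M)^t*) sigma| <= (x * t) ^+ 2 * (c - 1).
  rewrite (le_trans (abs_hs_le _ _)) // /c addrK mulrA ler_wpM2r ?mnorm_ge0 //.
  rewrite (le_trans (mnormM _ _)) // mnorm_adj expr2 mulrAC.
  rewrite ler_pM ?mnorm_ge0 // (le_trans (mnormM _ _)) // ler_wpM2r ?mnorm_ge0 //.
move: le_hs; rewrite dE !hsDl hsZl hsZ leNgt => /negP; apply.
rewrite -hsDl.
move: b1 b2; rewrite hsDl !ler_norml => /andP[b1 _] /andP[b2 _].
apply: (first_order_gt0 h0 t0 _ _ _ b1 b2).
- by rewrite lerDr mulr_ge0 ?mnorm_ge0.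
- by rewrite /e invfM mulrA divfK // gt_eqF.
by rewrite -ltr_pdivlMr // !mulr_gt0 // exprn_gt0.
Qed.

Lemma sandwich_diagD (Q : 'M[R[i]]_N) (u v : 'rV[R[i]]_N) :
  Q^t* *m diag_mx u *m Q + Q^t* *m diag_mx v *m Q = Q^t* *m diag_mx (u + v) *m Q.
Proof. by rewrite linearD /= mulmxDr mulmxDl. Qed.

Lemma sandwich_diagZ (Q : 'M[R[i]]_N) (c : R[i]) (u : 'rV[R[i]]_N) :
  Q^t* *m diag_mx (c *: u) *m Q = c *: (Q^t* *m diag_mx u *m Q).
Proof. by rewrite linearZ /= -scalemxAr -scalemxAl. Qed.

(** Commuting hermitian matrices make [rho + i sigma] normal, so a single spectral decomposition
    serves both; the two spectra are the real and imaginary parts of its eigenvalues. *)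
Lemma codiagonalise rho sigma : rho^t* = rho -> sigma^t* = sigma -> q_comm rho sigma = 0 ->
  exists (Q : 'M[R[i]]_N) (q p : 'I_N -> R), [/\ Q \is unitarymx,
    rho = Q^t* *m diag_mx (\row_k (q k)%:C) *m Q &
    sigma = Q^t* *m diag_mx (\row_k (p k)%:C) *m Q].
Proof.
move=> hr hsg /eqP; rewrite subr_eq0 => /eqP cm.
pose A := rho + 'i *: sigma.
have adjA : A^t* = rho - 'i *: sigma by rewrite adjD adjZ conjC_i scaleNr hr hsg.
have cA : A *m sigma = sigma *m A by rewrite mulmxDl mulmxDr cm -scalemxAl -scalemxAr.
have sumA : A + A^t* = 2 *: rho.
  by rewrite adjA addrACA subrr addr0 scaler_nat mulr2n.
have subA : A - A^t* = (2 * 'i) *: sigma.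
  by rewrite adjA opprB addrC addrA subrK -scalerDl mulr_natl mulr2n.
have nA : A \is normalmx.
  apply/normalmxP; have -> : A^t* = A - (2 * 'i) *: sigma by rewrite -subA opprB addrC subrK.
  by rewrite mulmxBr mulmxBl -scalemxAr -scalemxAl cA.
have [Q [d [uQ AE]]] := normal_spectral nA.
have adjAE : A^t* = Q^t* *m diag_mx (map_mx Num.conj d) *m Q.
  by rewrite AE !adjM trmxCK adj_diag mulmxA.
have nz2 : (2 : R[i]) != 0 by rewrite pnatr_eq0.
have nzi : 2 * 'i != 0 :> R[i].
  by rewrite mulf_neq0 // eq_complex /= oner_eq0 andbF.
have dsum : d + map_mx Num.conj d = 2 *: \row_k (complex.Re (d 0 k))%:C.
  by apply/rowP => k; rewrite !mxE; exact: addcJ.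
have dsub : d - map_mx Num.conj d = (2 * 'i) *: \row_k (complex.Im (d 0 k))%:C.
  by apply/rowP => k; rewrite !mxE mulrAC; exact: subcJ.
exists Q, (fun k => complex.Re (d 0 k)), (fun k => complex.Im (d 0 k)); split; first exact: uQ.
  apply: (scalerI nz2); rewrite -sumA adjAE {1}AE sandwich_diagD dsum sandwich_diagZ.
  reflexivity.
apply: (scalerI nzi); rewrite -subA adjAE {1}AE -scaleN1r -sandwich_diagZ sandwich_diagD.
rewrite scaleN1r dsub sandwich_diagZ; reflexivity.
Qed.

End Minimiser.

(** * Amplitude damping *)

Section AmplitudeDamping.
Context {R : realType}.

(** The last qubit is the least significant bit of the level index, so the jump operator lowers each
    odd level [j] to [j - 1]. *)
Definition decays n (i j : 'I_n) : bool := odd j && (j == i.+1 :> nat).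

Lemma id_tens (m n : nat) : (1%:M : 'M[R[i]]_m) *t (1%:M : 'M[R[i]]_n) = 1%:M.
Proof.
apply/matrixP => i j; rewrite !mxE -natrM mulnb; congr (_%:R); congr nat_of_bool.
by rewrite -(inj_eq (can_inj (@mxtens_unindexK m n))) xpair_eqE.
Qed.

Lemma id_ntens (n k : nat) : ntensmx (1%:M : 'M[R[i]]_n) k = 1%:M.
Proof.
case: k => [|k]; first exact: ntensmx0.
elim: k => [|k ih]; first exact: ntensmx1.
by rewrite ntensmxSS ih id_tens.
Qed.

Lemma q_VaE (n' : nat) (i j : 'I_(qdim n')) : (q_Va n' : 'M[R[i]]_(qdim n')) i j = (decays i j)%:R.
Proof.
rewrite /q_Va castmxE id_ntens mxE !mxE /decays -natrM mulnb; congr (_%:R); congr nat_of_bool.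
rewrite -val_eqE /= -[_ == 0]val_eqE -[_ == 1]val_eqE /= !modn2.
move: (val i) (val j) => {i j} i j.
rewrite -?divn2.
have := divn_eq i 2; have := divn_eq j 2; rewrite !modn2.
by case: (odd i) (odd j) => [] [] /=; lia.
Qed.

Lemma hs_diag n (g : 'I_n -> R) (M : 'M[R[i]]_n) :
  hs (diag_mx (\row_k (g k)%:C)) M = \sum_k g k * complex.Re (M k k).
Proof.
rewrite /hs adj_diag /mxtrace raddf_sum; apply: eq_bigr => k _ /=.
by rewrite mul_diag_mx !mxE conjC_real ReM /= mul0r subr0.
Qed.

(* Only populations enter: the Hamiltonian part of the generator has zero diagonal on a
   diagonal state. *)
Lemma hs_diag_lindblad n (A V : 'M[R[i]]_n) (gam : R) (q g : 'I_n -> R) (v : 'I_n -> 'I_n -> bool) :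
  A^t* = A -> (forall i j, V i j = (v i j)%:R) ->
  hs (diag_mx (\row_k (g k)%:C))
     (lindblad (- ('i *: A) - (gam / 2)%:C *: (V^t* *m V)) V gam (diag_mx (\row_k (q k)%:C)))
  = gam * \sum_i \sum_j (v i j)%:R * (q j * (g i - g j)).
Proof.
move=> hA hV; rewrite hs_diag.
have imA k : complex.Im (A k k) = 0.
  have := congr1 (fun M : 'M[R[i]]_n => complex.Im (M k k)) hA.
  rewrite /= !mxE ImJ => /eqP; rewrite eq_sym -subr_eq0 opprK -mulr2n mulrn_eq0.
  by move=> /eqP.
have ReB (b : bool) : complex.Re (b%:R : R[i]) = b%:R by case: b.
have ImB (b : bool) : complex.Im (b%:R : R[i]) = 0 by case: b.
have VV k : (V^t* *m V) k k = (\sum_i (v i k)%:R)%:C.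
  rewrite mxE rmorph_sum; apply: eq_bigr => i _; rewrite !mxE hV rmorph_nat.
  by case: (v i k); rewrite ?mulr1 ?mulr0.
have VXV k : complex.Re ((V *m diag_mx (\row_k (q k)%:C) *m V^t*) k k) = \sum_j (v k j)%:R * q j.
  rewrite mxE raddf_sum; apply: eq_bigr => j _ /=.
  by rewrite mul_mx_diag !mxE hV rmorph_nat !ReM ReB ImB !(mulr0, mul0r, subr0);
    case: (v k j); rewrite ?mulr1 ?mulr0 ?mul0r.
set G := _ - _.
have ReG k : complex.Re (G k k) = - (gam / 2) * \sum_i (v i k)%:R.
  have -> : G k k = - ('i * A k k) - (gam / 2)%:C * (V^t* *m V) k k.
    by rewrite /G [LHS]mxE; congr (_ + _); rewrite mxE; congr (- _); rewrite mxE.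
  rewrite VV ReD; case: (A k k) (imA k) => a b /= ->.
  by rewrite !(mul0r, mul1r, mulr0, subr0, add0r, addr0, oppr0, subrr) mulNr.
clearbody G.
have LE k : complex.Re (lindblad G V gam (diag_mx (\row_k (q k)%:C)) k k) =
    gam * (\sum_j (v k j)%:R * q j - q k * \sum_i (v i k)%:R).
  set D := diag_mx _ in VXV *.
  have -> : lindblad G V gam D k k =
      (G *m D) k k + (D *m G^t*) k k + gam%:C * (V *m D *m V^t*) k k.
    by rewrite /lindblad [LHS]mxE [X in X + _]mxE [X in _ + X]mxE.
  have -> : (G *m D) k k = G k k * (q k)%:C by rewrite mul_mx_diag !mxE.
  have -> : (D *m G^t*) k k = (q k)%:C * Num.conj (G k k) by rewrite mul_diag_mx !mxE.
  rewrite !ReD !ReM VXV ReJ ReG /= !(mulr0, mul0r, subr0).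
  by move: (\sum_j _) (\sum_i _) => S1 S2; field.
under eq_bigr do rewrite LE.
rewrite mulr_sumr.
transitivity (gam * (\sum_k \sum_j (v k j)%:R * (q j * g k) -
                     \sum_k \sum_i (v i k)%:R * (q k * g k))).
  rewrite -sumrB mulr_sumr; apply: eq_bigr => k _; rewrite mulrCA; congr (_ * _).
  rewrite mulrBr mulr_sumr; congr (_ - _); first by apply: eq_bigr => j _; ring.
  by rewrite mulrA mulr_sumr; apply: eq_bigr => j _; ring.
rewrite [X in _ - X]exchange_big /= -sumrB mulr_sumr; apply: eq_bigr => k _.
by rewrite -sumrB; congr (_ * _); apply: eq_bigr => j _; ring.
Qed.

End AmplitudeDamping.

Section Descent.
Context {R : realType} (n' : nat).
Local Notation N := (qdim n').
Implicit Types i j : 'I_N.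

Lemma qdim_even : ~~ odd N.
Proof. by rewrite /qdim expnS mul2n odd_double. Qed.

Lemma qdim_gt1 : (1 < N)%N.
Proof. by rewrite /qdim -{1}(expn0 2) ltn_exp2l. Qed.

(** Toggles the last bit. The default of [insubd] is never taken: [N] is even, so an even level
    below [N] has its successor below [N] too. *)
Definition flip i : 'I_N := insubd i (if odd i then i.-1 else i.+1).

Lemma flipE i : flip i = (if odd i then i.-1 else i.+1) :> nat.
Proof.
rewrite val_insubd; case: ifP => // /negbT; case: ifP => oi; rewrite -leqNgt => h.
  by have := ltn_ord i; have := leq_pred i; lia.
have E : i.+1 = N by apply/eqP; rewrite eqn_leq h andbT.
by move: (congr1 odd E); rewrite /= oi (negPf qdim_even).
Qed.

Lemma odd_flip i : odd (flip i) = ~~ odd i.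
Proof. by rewrite flipE; case: ifP => //= oi; case: (val i) oi => //= k; case: (odd k). Qed.

Lemma flipK : involutive flip.
Proof.
move=> i; apply: val_inj; rewrite /= flipE odd_flip flipE.
by case: (odd i) (odd_gt0 (n := i)) => /= h; rewrite // prednK // h.
Qed.

Lemma decays_flip i j : decays i j -> i = flip j.
Proof.
by case/andP => oj /eqP ji; apply: val_inj; rewrite /= flipE oj ji.
Qed.

(* Each pair is ordered so that its decay transports population from the larger to the smaller
   value of the gradient [q - p]; the pair at level 0, 1 is chosen with a strict gap. *)
Lemma exists_descent (q p : 'I_N -> R) :
  (forall k, 0 <= p k) -> (forall k, 0 <= q k) -> \sum_k q k = \sum_k p k ->
  (exists k, q k != p k) ->
  exists pi : {perm 'I_N}, \sum_i \sum_j (decays i j)%:R *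
      (q (pi j) * ((q (pi i) - p (pi i)) - (q (pi j) - p (pi j)))) < 0.
Proof.
move=> p0 q0 qp [k0 hk0]; pose g k := q k - p k.
have sum_g : \sum_k g k = 0 by rewrite sumrB qp subrr.
have sum_Ng : \sum_k - g k = 0 by rewrite sumrN sum_g oppr0.
have [a ga] : exists a, 0 < g a.
  apply: contrapT => h; move: sum_Ng => /eqP; rewrite psumr_eq0 => [|k _].
    by move=> /allP /(_ k0 (mem_index_enum _)); rewrite oppr_eq0 subr_eq0 (negPf hk0).
  by rewrite oppr_ge0 leNgt; apply/negP => gk; apply: h; exists k.
have [b gb] : exists b, g b < 0.
  apply: contrapT => h; move: sum_g => /eqP; rewrite psumr_eq0 => [|k _].
    by move=> /allP /(_ k0 (mem_index_enum _)); rewrite subr_eq0 (negPf hk0).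
  by rewrite leNgt; apply/negP => gk; apply: h; exists k.
pose o0 : 'I_N := Ordinal (ltnW qdim_gt1); pose o1 : 'I_N := Ordinal qdim_gt1.
have ab : b != a by apply: contraTneq gb => ->; rewrite -leNgt ltW.
(* The preimage of [a] under the second transposition of [s]; it accounts for the case [a = o0]. As
   a result [s] puts [b] at level 0 and [a] at level 1. *)
pose a' := tperm o0 b a.
have a'0 : a' != o0.
  by rewrite /a' -(inj_eq (@perm_inj _ (tperm o0 b))) tpermK tpermL eq_sym.
pose s := (tperm o1 a' * tperm o0 b)%g.
have s0 : s o0 = b.
  by rewrite permM (_ : tperm o1 a' o0 = o0) ?tpermL // tpermD.
have s1 : s o1 = a by rewrite permM tpermL tpermK.
pose low i := if odd i then flip i else i.
(* The decision to exchange a pair depends only on its lower level, so it is the same for both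
   members and [c] is an involution, hence a permutation. *)
pose c i := if g (s (low i)) <= g (s (flip (low i))) then i else flip i.
have low_flip i : low (flip i) = low i.
  by rewrite /low odd_flip; case: (odd i); rewrite //= flipK.
have cK : involutive c.
  by move=> i; rewrite {2}/c; case: ifP => h; rewrite /c ?low_flip h // flipK.
exists (perm (can_inj cK) * s)%g.
have piE i : (perm (can_inj cK) * s)%g i = s (c i) by rewrite permM permE.
have term i j : (decays i j)%:R * (q (s (c j)) * (g (s (c i)) - g (s (c j)))) <= 0.
  have [dij|] := boolP (decays i j); last by rewrite mul0r.
  rewrite mul1r mulr_ge0_le0 // subr_le0.
  have iE := decays_flip dij; have oj : odd j by case/andP: dij.
  have li : low i = i by rewrite /low iE odd_flip oj.
  have lj : low j = i by rewrite /low oj iE.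
  rewrite /c li lj iE flipK -iE; case: ifP => // /negbT; rewrite -ltNge => /ltW.
  by [].
have strict : (decays o0 o1)%:R * (q (s (c o1)) * (g (s (c o0)) - g (s (c o1)))) < 0.
  have f0 : flip o0 = o1 by apply: val_inj; rewrite /= flipE.
  have f1 : flip o1 = o0 by rewrite -f0 flipK.
  have hle : g (s o0) <= g (s o1) by rewrite s0 s1 ltW // (lt_trans gb).
  have c0 : c o0 = o0 by rewrite /c /low /= f0 hle.
  have c1 : c o1 = o1 by rewrite /c /low /= f1 f0 hle.
  (* From [q a > p a >= 0] the decaying level is actually populated; without this the strict gap
     would produce no flow. *)
  rewrite c0 c1 s0 s1 mul1r nmulr_llt0; first by rewrite (le_lt_trans (p0 a)) // -subr_gt0.
  by rewrite subr_lt0 (lt_trans gb).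
under eq_bigr do under eq_bigr do rewrite !piE -!/(g _).
rewrite (bigD1 o0) //= (bigD1 o1) //= -addrA -[ltRHS]addr0.
apply: ltr_leD; first exact: strict.
rewrite -[leRHS]addr0; apply: lerD; first by apply: sumr_le0 => j _; exact: term.
by apply: sumr_le0 => i _; apply: sumr_le0 => j _; exact: term.
Qed.

End Descent.

(** * Closure of the reachable set *)

Section Closure.
Context {R : realType} {N : nat}.

Definition mclosure (S : 'M[R[i]]_N -> Prop) X : Prop :=
  forall eps : R, 0 < eps -> exists2 Y, S Y & mnorm (Y - X) < eps.

Lemma mclosure_closed S : mclosed (mclosure S).
Proof.
move=> X hX eps eps0; have e2 : 0 < eps / 2 by rewrite divr_gt0.
have [Y hY YX] := hX _ e2; have [Z SZ ZY] := hY _ e2; exists Z => //.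
by rewrite (le_lt_trans (mnorm_triangle Y _ _)) // [eps]splitr ltrD.
Qed.

Lemma sub_mclosure (S : 'M[R[i]]_N -> Prop) X : S X -> mclosure S X.
Proof. by move=> SX eps eps0; exists X => //; rewrite subrr mnorm0. Qed.

Lemma mclosure_min (S K : 'M[R[i]]_N -> Prop) : mclosed K -> (forall X, S X -> K X) ->
  forall X, mclosure S X -> K X.
Proof.
move=> K_closed SK X hX; apply: K_closed => eps /hX [Y SY YX].
by exists Y => //; exact: SK.
Qed.

Lemma mderiv_0_cst (f : R -> 'M[R[i]]_N) : (forall s : R, mderiv f s 0) -> forall t, f t = f 0.
Proof.
move=> hf t; apply/matrixP => i j; apply/eqP; rewrite eq_complex.
have h s := hf s i j; rewrite mxE in h.
rewrite (is_derive_0_is_cst t 0 (fun s => (h s).1)).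
by rewrite (is_derive_0_is_cst t 0 (fun s => (h s).2)) !eqxx.
Qed.

Lemma ode_lipschitz (L : 'M[R[i]]_N -> 'M[R[i]]_N) t : bounded_linear L -> 0 <= t ->
  exists2 C, 0 < C & forall f g : R -> 'M[R[i]]_N,
    (forall s : R, mderiv f s (L (f s))) -> (forall s : R, mderiv g s (L (g s))) ->
    mnorm (f t - g t) <= C * mnorm (f 0 - g 0).
Proof.
move=> hL t0; have [c hc] := hs_gronwall hL.
pose C2 := (N * N)%:R * expR (c * t) + 1.
have C20 : 0 < C2 by rewrite ltr_wpDl // mulr_ge0 ?expR_ge0.
exists (Num.sqrt C2) => [|f g hf hg]; first by rewrite sqrtr_gt0.
have hfg s : mderiv (fun x => f x - g x) s (L (f s - g s)).
  by rewrite (bounded_linearB hL); exact: mderivB.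
have h := hc _ hfg t t0.
rewrite -(@ler_pXn2r _ 2) ?nnegrE ?mulr_ge0 ?mnorm_ge0 ?sqrtr_ge0 //.
rewrite exprMn sqr_sqrtr ?(ltW C20) // (le_trans (mnorm_sqr_le _)) //.
apply: (@le_trans _ _ ((N * N)%:R * (expR (c * t) * mnorm (f 0 - g 0) ^+ 2))).
  rewrite ler_wpM2l // (le_trans h) // ler_wpM2l ?expR_ge0 // expr2.
  exact: le_trans (ler_norm _) (abs_hs_le _ _).
by rewrite mulrA ler_wpM2r ?sqr_ge0 // lerDl.
Qed.

(** Start a solution at a nearby point of [S] and compare by Lipschitz dependence; existence of
    solutions from every initial value is essential here. *)
Lemma flow_mclosure (S : 'M[R[i]]_N -> Prop) (L : 'M[R[i]]_N -> 'M[R[i]]_N) t :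
  bounded_linear L -> 0 <= t ->
  (forall f : R -> 'M[R[i]]_N, (forall s : R, mderiv f s (L (f s))) -> S (f 0) -> S (f t)) ->
  forall f : R -> 'M[R[i]]_N, (forall s : R, mderiv f s (L (f s))) ->
    mclosure S (f 0) -> mclosure S (f t).
Proof.
move=> hL t0 hS f hf Sf eps eps0; have [C C0 hC] := ode_lipschitz hL t0.
have e0 : 0 < eps / C by rewrite divr_gt0.
have [Y SY Yf] := Sf _ e0; have [g [g0 hg]] := ode_exists Y hL.
exists (g t); first by apply: hS => //; rewrite g0.
by rewrite (le_lt_trans (hC _ _ hg hf)) // g0 mulrC -ltr_pdivlMr.
Qed.

Lemma density_closed : mclosed (@q_density R N).
Proof.
move=> X hX.
have {}hX eps : 0 < eps -> exists Y, [/\ Y^t* = Y, psd Y, \tr Y = 1 & mnorm (Y - X) < eps].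
  by move=> /hX [Y /q_densityP[? ? ?] ?]; exists Y.
apply/q_densityP; split.
- apply/eqP; rewrite -subr_eq0; apply/eqP/mnorm_eq0 => eps eps0.
  have e2 : 0 < eps / 2 by rewrite divr_gt0.
  have [Y [hY _ _ YX]] := hX _ e2.
  rewrite (le_lt_trans (mnorm_triangle Y _ _)) // [eps]splitr ltrD //.
  by rewrite -hY -adjB mnorm_adj mnorm_distC.
- move=> v; rewrite leNgt; apply/negP => hv.
  pose c := mnorm v * mnorm v + 1; have c0 : 0 < c by rewrite ltr_wpDl // mulr_ge0 ?mnorm_ge0.
  have e0 : 0 < - hs v (X *m v) / c by rewrite divr_gt0 // oppr_gt0.
  have [Y [_ pY _ YX]] := hX _ e0.
  have := pY v; rewrite -(subrK X Y) mulmxDl hsDr leNgt => /negP; apply.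
  rewrite -ltrBrDr sub0r (le_lt_trans (ler_norm _)) // (le_lt_trans (abs_hs_le _ _)) //.
  apply: (@le_lt_trans _ _ (mnorm (Y - X) * c)); last by rewrite -ltr_pdivlMr.
  rewrite /c mulrDr mulr1 ler_wpDr ?mnorm_ge0 // mulrCA ler_wpM2l ?mnorm_ge0 //.
  exact: mnormM.
apply/eqP; rewrite -subr_eq0; apply/eqP/cnorm_eq0/eqP.
rewrite eq_le cnorm_ge0 andbT leNgt; apply/negP => /hX [Y [_ _ <-]].
by rewrite -raddfB /= mnorm_distC ltNge cnorm_tr.
Qed.

End Closure.

(** * Spectra of density operators *)

Section Spectrum.
Context {R : realType} {N : nat}.
Implicit Types (Q rho : 'M[R[i]]_N).

Definition rdiag (q : 'I_N -> R) : 'M[R[i]]_N := diag_mx (\row_k (q k)%:C).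

Lemma hs_delta (k : 'I_N) (w : 'cV[R[i]]_N) : hs (delta_mx k 0) w = complex.Re (w k 0).
Proof. by rewrite /hs trmx_delta map_delta_mx -rowE /mxtrace big_ord1 mxE. Qed.

Lemma density_spectrum Q rho (q : 'I_N -> R) : Q \is unitarymx ->
  rho = Q^t* *m rdiag q *m Q -> q_density rho -> (forall k, 0 <= q k) /\ \sum_k q k = 1.
Proof.
move=> uQ rhoE /q_densityP[_ prho trho]; split=> [k|].
  have := prho (Q^t* *m delta_mx k 0).
  rewrite rhoE -!mulmxA hs_mull trmxCK (mulmxA Q) (unitary_mulmV uQ) mul1mx.
  rewrite hs_delta /rdiag mul_diag_mx !mxE !eqxx.
  by rewrite mulr1.
move: trho; rewrite rhoE mxtrace_mulC mulmxA (unitary_mulmV uQ) mul1mx /rdiag mxtrace_diag.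
under eq_bigr do rewrite mxE.
by rewrite -rmorph_sum => /(congr1 (@complex.Re R)).
Qed.

(** Eigenvalues are nonnegative with sum one, hence at most one. The spectral form is obtained by
    codiagonalising [rho] with itself. *)
Lemma density_bounded rho : q_density rho -> mnorm rho <= @unorm R N * @unorm R N * (N * N)%:R.
Proof.
move=> drho; have [hr _ _] := (q_densityP rho).1 drho.
have comm0 : q_comm rho rho = 0 by rewrite /q_comm subrr.
have [Q [q [_ [uQ rhoE _]]]] := codiagonalise hr hr comm0.
have [q0 q1] := density_spectrum uQ rhoE drho.
have -> : rho = conjU (Q^t*) (rdiag q) by rewrite /conjU trmxCK.
rewrite (le_trans (mnorm_conjU _ (unitary_adj uQ))) // ler_wpM2l ?mulr_ge0 ?ler0n //.
rewrite -[leRHS]mulr1; apply: mnorm_le_entry => i j; rewrite !mxE.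
case: eqP => _; rewrite ?mulr0n ?cnorm0 // mulr1n cnorm_real ger0_norm //.
by rewrite -q1 (bigD1 i) //= lerDl sumr_ge0.
Qed.

Lemma perm_conj_diag (s : {perm 'I_N}) (q : 'I_N -> R) :
  conjU (perm_mx s) (rdiag q) = rdiag (fun k => q (s k)).
Proof.
rewrite /conjU tr_perm_mx map_perm_mx -row_permE -col_permE.
by apply/matrixP => i j; rewrite !mxE (inj_eq (@perm_inj _ s)).
Qed.

Lemma perm_unitary (s : {perm 'I_N}) : (perm_mx s : 'M[R[i]]_N) \is unitarymx.
Proof. by apply/unitarymxP; rewrite tr_perm_mx map_perm_mx -perm_mxM mulgV perm_mx1. Qed.

End Spectrum.

(** * The control system and the final descent *)

Section System.
Context {R : realType} {n' m : nat}.
Local Notation N := (qdim n').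
Implicit Types (A V X : 'M[R[i]]_N).

Lemma is_derive_lt0_right (h : R -> R) (s d : R) : is_derive s 1 h d -> d < 0 ->
  exists2 t, 0 < t & h (s + t) < h s.
Proof.
move=> /is_derive_littleo hd d0; have d2 : 0 < - d / 2 by rewrite divr_gt0 // oppr_gt0.
have [delta delta0 hdelta] := hd _ d2.
have t0 : 0 < delta / 2 by rewrite divr_gt0.
exists (delta / 2) => //.
have := hdelta (delta / 2); rewrite gtr0_norm // ltr_pdivrMr // ltr_pMr // ltr1n => /(_ isT).
move=> /(le_trans (ler_norm _)); rewrite -subr_ge0.
have : d * (delta / 2) < 0 by rewrite nmulr_rlt0.
by move: (h (s + _)) (h s) => a b; lra.
Qed.

Definition lindblad_drift A V (g : R) : 'M[R[i]]_N := - ('i *: A) - (g / 2)%:C *: (V^t* *m V).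

Lemma lindblad_drift_adj A V g : A^t* = A ->
  (lindblad_drift A V g)^t* = 'i *: A - (g / 2)%:C *: (V^t* *m V).
Proof.
move=> hA; rewrite /lindblad_drift adjB adjN !adjZ adjM trmxCK hA conjC_i conjC_real.
by rewrite scaleNr opprK.
Qed.

Lemma lindblad_drift_tr A V g : A^t* = A ->
  lindblad_drift A V g + (lindblad_drift A V g)^t* + g%:C *: (V^t* *m V) = 0.
Proof.
move=> hA; rewrite lindblad_drift_adj // /lindblad_drift addrACA addNr add0r.
rewrite [X in _ + X%:C *: _]splitr rmorphD scalerDl addrACA !addNr addr0.
by [].
Qed.

(** On a kernel vector [v] both drift terms vanish, one because [X v = 0] and the other because
    [v^* X = 0]. What remains is [g] times the form of [X] at [V^* v]. *)
Lemma lindblad_boundary A V (g : R) X (v : 'cV[R[i]]_N) : 0 <= g ->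
  X^t* = X -> psd X -> X *m v = 0 ->
  0 <= hs v (lindblad (lindblad_drift A V g) V g X *m v).
Proof.
move=> g0 hX pX Xv; rewrite /lindblad; move: (lindblad_drift A V g) => G.
rewrite !mulmxDl !hsDr -[G *m X *m v]mulmxA Xv mulmx0 hs0r add0r.
rewrite -(mulmxA X) hs_mull hX Xv [hs 0 _]hsC hs0r add0r.
rewrite -scalemxAl hsZr mulr_ge0 // -!mulmxA hs_mull; exact: pX.
Qed.

Variables (H0 : 'M[R[i]]_N) (H : 'I_m -> 'M[R[i]]_N).

Lemma q_generator_lindblad (u : 'I_m -> R) g X : (q_Hu H0 H u)^t* = q_Hu H0 H u ->
  q_generator n' m H0 H u g X =
  lindblad (lindblad_drift (q_Hu H0 H u) (q_Va n') g) (q_Va n') g X.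
Proof.
rewrite /q_generator; move: (q_Hu H0 H u) => A hA; rewrite /lindblad lindblad_drift_adj //.
rewrite /lindblad_drift /q_Gamma_a !q_adjE; move: (q_Va n') => V.
have gh : (g / 2)%:C = g%:C * 2%:R^-1 :> R[i] by rewrite rmorphM fmorphV rmorph_nat.
have -> : 'i *: q_comm A X = 'i *: (A *m X) - 'i *: (X *m A) by rewrite scalerBr.
have -> : g%:C *: - (V *m X *m V^t* - 2%:R^-1 *: (V^t* *m V *m X + X *m V^t* *m V)) =
    - (g%:C *: (V *m X *m V^t*) -
       ((g / 2)%:C *: (V^t* *m V *m X) + (g / 2)%:C *: (X *m V^t* *m V))).
  by rewrite scalerN scalerBr scalerA -gh scalerDr.
have -> : (- ('i *: A) - (g / 2)%:C *: (V^t* *m V)) *m X =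
    - ('i *: (A *m X)) - (g / 2)%:C *: (V^t* *m V *m X).
  by rewrite mulmxBl mulNmx -!scalemxAl.
have -> : X *m ('i *: A - (g / 2)%:C *: (V^t* *m V)) =
    'i *: (X *m A) - (g / 2)%:C *: (X *m V^t* *m V).
  by rewrite mulmxBr -!scalemxAr mulmxA.
have key (a b c d w : 'M[R[i]]_N) :
    - ((a - b) + - (w - (c + d))) = (- a - c) + (b - d) + w.
  by rewrite opprD opprK opprB (addrACA (- a)) (addrC (- a)) -opprD -(addrA (b - a)) (addrC (- (c + d))).
exact: key.
Qed.

Lemma q_generator_bounded (u : 'I_m -> R) g : 0 <= g -> (q_Hu H0 H u)^t* = q_Hu H0 H u ->
  bounded_linear (q_generator n' m H0 H u g).
Proof.
move=> g0 hA; have -> : q_generator n' m H0 H u g =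
    lindblad (lindblad_drift (q_Hu H0 H u) (q_Va n') g) (q_Va n') g.
  by apply/funext => X; exact: q_generator_lindblad.
exact: lindblad_bounded.
Qed.

Hypothesis hH0 : q_hermitian H0.
Hypothesis hH : forall j, q_hermitian (H j).

Lemma q_Hu_herm (u : 'I_m -> R) : (q_Hu H0 H u)^t* = q_Hu H0 H u.
Proof.
rewrite /q_Hu adjD -q_adjE hH0; congr (_ + _).
apply/matrixP => i j; rewrite !mxE !summxE rmorph_sum; apply: eq_bigr => k _.
rewrite [in RHS]mxE -[in RHS](hH k) !mxE rmorphM /= conjC_real; congr (_ * _).
Qed.

Lemma flow_density (u : 'I_m -> R) g (f : R -> 'M[R[i]]_N) : 0 <= g ->
  (forall s : R, mderiv f s (q_generator n' m H0 H u g (f s))) ->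
  q_density (f 0) -> forall t, 0 <= t -> q_density (f t).
Proof.
move=> g0 hf /q_densityP[h0 p0 t0] t tge0.
have hA := q_Hu_herm u; move: (q_Hu_herm u); set A := q_Hu H0 H u => {}hA.
pose L := lindblad (lindblad_drift A (q_Va n') g) (q_Va n') g.
have hfL (s : R) : mderiv f s (L (f s)) by rewrite -[L _]q_generator_lindblad.
have herm := lindblad_flow_herm g0 hfL h0.
apply/q_densityP; split; first exact: herm.
- apply: (@psd_flow _ _ L) => //; first exact: lindblad_bounded.
  by move=> X v hX pX Xv; exact: lindblad_boundary.
- by rewrite (lindblad_flow_tr hfL) // lindblad_drift_tr.
Qed.

(* For [gamma = 0] the flow is conjugation by the solution of [W' = - i A W]. *)
Lemma unitary_flow (u : 'I_m -> R) : exists W : R -> 'M[R[i]]_N,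
  [/\ W 0 = 1%:M, mderiv W 0 (- ('i *: q_Hu H0 H u)), forall s, W s \is unitarymx &
      forall X (s : R), mderiv (fun x => conjU (W x) X) s
        (q_generator n' m H0 H u 0 (conjU (W s) X))].
Proof.
have hA := q_Hu_herm u; rewrite /q_generator; move: (q_Hu H0 H u) hA => A hA.
pose L X : 'M[R[i]]_N := - ('i *: A) *m X.
have hL : bounded_linear L.
  split=> [X Y|r X|]; first exact: mulmxDr.
  - by rewrite /L scalemxAr.
  - by exists (mnorm (- ('i *: A))); [exact: mnorm_ge0 | move=> X; exact: mnormM].
have [W [W0 dW]] := ode_exists 1%:M hL.
have dW' s : mderiv (fun x => (W x)^t*) s ((W s)^t* *m ('i *: A)).
  apply: mderiv_congr (mderiv_adj (dW s)) => //.
  by rewrite /L adjM adjN adjZ conjC_i scaleNr opprK hA.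
exists W; split=> //.
- by have := dW 0; rewrite /L W0 mulmx1.
- move=> s; apply/unitarymxP; apply: mulmx1C.
  have h (x : R) : mderiv (fun y => (W y)^t* *m W y) x 0.
    apply: mderiv_congr (mderivM (dW' x) (dW x)) => //.
    by rewrite /L mulNmx mulmxN mulmxA subrr.
  by rewrite (mderiv_0_cst h) W0 adj1 mulmx1.
move=> X s; apply: mderiv_congr (mderivM (mderiv_mulr X (dW s)) (dW' s)) => //.
rewrite /L /conjU scale0r addr0 /q_comm scalerBr opprB mulNmx mulNmx addrC.
by rewrite -!scalemxAl -!scalemxAr !mulmxA mulNmx -scalemxAl.
Qed.

Variable gstar : R.
Hypothesis gstar_gt0 : 0 < gstar.
Variable rho0 : 'M[R[i]]_N.
Hypothesis rho0_density : q_density rho0.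
Local Notation reach := (q_reach R n' m H0 H gstar rho0).
Local Notation K := (mclosure reach).

Lemma reach_density rho : reach rho -> q_density rho.
Proof.
elim=> // rho1 rho2 t u g _ d1 t0 hg [f [f0 ft hf]].
have g0 : 0 <= g by case: hg => ->; rewrite ?lexx ?ltW.
by rewrite -ft; apply: (@flow_density u g f) => //; rewrite f0.
Qed.

Lemma flow_reach_closure (u : 'I_m -> R) g (f : R -> 'M[R[i]]_N) : g = 0 \/ g = gstar ->
  (forall s : R, mderiv f s (q_generator n' m H0 H u g (f s))) ->
  K (f 0) -> forall t, 0 <= t -> K (f t).
Proof.
move=> hg hf Kf t t0; have g0 : 0 <= g by case: hg => ->; rewrite ?lexx ?ltW.
have hL := q_generator_bounded g0 (q_Hu_herm u).
apply: (flow_mclosure hL t0 _ hf Kf) => k hk rk.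
by apply: (q_reach_step _ _ _ _ _ _ _ (k 0) (k t) t u g) => //; exists k.
Qed.

Lemma tangent_Hu (u : 'I_m -> R) : tangent K (- ('i *: q_Hu H0 H u)).
Proof.
have [W [W0 dW uW flow]] := unitary_flow u.
apply: (tangent_curve _ W0 dW) => [|t t0].
  by rewrite adjN adjZ conjC_i scaleNr q_Hu_herm.
split=> // X KX; apply: (flow_reach_closure (or_introl erefl) (flow X)); last exact: ltW.
by rewrite W0 /conjU adj1 mul1mx mulmx1.
Qed.

Hypothesis controllable : forall X : 'M[R[i]]_N,
  q_lie_gen (fun Y => Y = q_imul H0 \/ exists j, Y = q_imul (H j)) X <-> q_su X.

Lemma tangent_su X : q_su X -> tangent K X.
Proof.
have Kc := @mclosure_closed R N reach.
move=> /controllable; apply; first exact: tangent_lie_closed.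
have t0 : tangent K (- q_imul H0).
  by have := tangent_Hu (fun=> 0); rewrite /q_Hu big1 ?addr0 // => j _; rewrite scale0r.
move=> Y [->|[j ->]]; first by rewrite -[q_imul H0]opprK; exact: tangentN.
(* Taking the [j]-th unit vector as control yields the generator of [H0 + H j]; the drift is always
   present and is removed by subtraction. *)
have tj : tangent K (- (q_imul H0 + q_imul (H j))).
  have E : \sum_k ((k == j)%:R : R)%:C *: H k = H j.
    rewrite (bigD1 j) // big1 => [|k /negPf kj]; last by rewrite kj scale0r.
    by rewrite eqxx; exact: etrans (addr0 _) (scale1r _).
  by have := tangent_Hu (fun k => (k == j)%:R); rewrite /q_Hu E scalerDr.
have := tangentD (tangentN Kc tj) t0.
by rewrite opprK addrC addKr.
Qed.

Lemma reach_closure_unitary (U X : 'M[R[i]]_N) : U \is unitarymx -> K X -> K (conjU U X).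
Proof.
have Kc := @mclosure_closed R N reach.
move=> uU; apply: (stab_unitary Kc _ uU).2.
apply: tangent_antiherm => //; last exact: tangent_su.
exact: ltnW (qdim_gt1 n').
Qed.

Lemma reach_closure_full sigma : q_density sigma -> K sigma.
Proof.
move=> dsigma; have Kc := @mclosure_closed R N reach.
have Kdens := mclosure_min (@density_closed R N) reach_density.
have [|rho [Krho near]] := exists_nearest sigma Kc (fun X KX => density_bounded (Kdens X KX)).
  by exists rho0; apply: sub_mclosure; exact: q_reach_start.
have drho := Kdens _ Krho.
have [hr _ _] := (q_densityP rho).1 drho; have [hsig _ _] := (q_densityP sigma).1 dsigma.
have tall := tangent_antiherm Kc (ltnW (qdim_gt1 n')) tangent_su.
have [Q [q [p [uQ rhoE sigmaE]]]] := codiagonalise hr hsig (nearest_comm tall hr hsig Krho near).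
have [q0 q1] := density_spectrum uQ rhoE drho.
have [p0 p1] := density_spectrum uQ sigmaE dsigma.
have [qp|/existsNP[k /eqP qk]] := pselect (forall k, q k = p k).
  suff <- : rho = sigma by [].
  by rewrite rhoE sigmaE; do 2!congr (_ *m _); congr diag_mx; apply/rowP => k; rewrite !mxE qp.
exfalso; have [|pi hpi] := exists_descent p0 q0 _ (ex_intro _ k qk); first by rewrite q1 p1.
pose U := perm_mx pi *m Q; have uU : U \is unitarymx by exact: unitaryM (perm_unitary pi) uQ.
have conjE (r : 'I_N -> R) : conjU U (Q^t* *m rdiag r *m Q) = rdiag (fun k => r (pi k)).
  rewrite -perm_conj_diag -conjU_conjU; congr conjU.
  by rewrite /conjU !mulmxA (unitary_mulmV uQ) mul1mx -mulmxA (unitary_mulmV uQ) mulmx1.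
have rhoU : conjU U rho = rdiag (fun k => q (pi k)) by rewrite rhoE conjE.
have sigmaU : conjU U sigma = rdiag (fun k => p (pi k)) by rewrite sigmaE conjE.
have hA := q_Hu_herm (fun=> 0); pose L := q_generator n' m H0 H (fun=> 0) gstar.
have [f [f0 hf]] := ode_exists (conjU U rho) (q_generator_bounded (ltW gstar_gt0) hA).
have Kf t : 0 <= t -> K (f t).
  apply: (flow_reach_closure (or_intror erefl) hf).
  by rewrite f0; exact: reach_closure_unitary.
(* Minimality is transported to the conjugated pair by conjugating back with [U^*], under which [K]
   is invariant. *)
have nearU t : 0 <= t -> dist2 (f 0) (conjU U sigma) <= dist2 (f t) (conjU U sigma).
  move=> t0; have uU' := unitary_adj uU.
  have e1 := dist2_conjU rho sigma uU; have e2 := dist2_conjU (f t) (conjU U sigma) uU'.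
  rewrite f0 e1 -e2 conjU_conjU (unitary_mulVm uU).
  have -> : conjU 1%:M sigma = sigma by rewrite /conjU adj1 mul1mx mulmx1.
  by apply: near; exact: reach_closure_unitary uU' (Kf t t0).
have dB s : mderiv (fun x => f x - conjU U sigma) s (q_generator n' m H0 H (fun=> 0) gstar (f s)).
  by have := mderivB (hf s) (mderiv_cst (conjU U sigma) s); rewrite subr0.
(* At time 0 the squared distance has derivative [2 * hs (f 0 - conjU U sigma) (L (f 0))], which
   equals [2 * gstar] times the negative sum provided by the choice of [pi]. *)
have [|t t0] := is_derive_lt0_right (is_derive_hs (dB 0) (dB 0)).
  rewrite hsC -mulr2n pmulrn_llt0 // f0 q_generator_lindblad //.
  have -> : conjU U rho - conjU U sigma = rdiag (fun k => q (pi k) - p (pi k)).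
    rewrite rhoU sigmaU /rdiag -raddfB /=; congr diag_mx; apply/rowP => j.
    by rewrite !mxE rmorphB.
  rewrite rhoU (hs_diag_lindblad _ _ _ hA (@q_VaE R n')).
  by rewrite pmulr_rlt0.
by rewrite add0r ltNge => /negP; apply; exact: nearU (ltW t0).
Qed.

End System.

Theorem theorem1 (R : realType) (n' m : nat) (H0 : 'M[R[i]]_(qdim n'))
  (H : 'I_m -> 'M[R[i]]_(qdim n')) (gstar : R) :
  0 < gstar ->
  q_hermitian H0 -> (forall j, q_hermitian (H j)) ->
  (forall X : 'M[R[i]]_(qdim n'),
     q_lie_gen (fun Y => Y = q_imul H0 \/ exists j, Y = q_imul (H j)) X <-> q_su X) ->
  forall rho0 : 'M[R[i]]_(qdim n'), q_density rho0 ->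
    (forall rho, q_reach R n' m H0 H gstar rho0 rho -> q_density rho) /\
    (forall rho, q_density rho -> forall eps : R, 0 < eps ->
       exists rho1, q_reach R n' m H0 H gstar rho0 rho1 /\
         forall i j, `|rho1 i j - rho i j| < eps%:C).
Proof.
move=> g0 hH0 hH controllable rho0 d0; split=> [rho|rho drho eps eps0].
  exact: reach_density.
have [rho1 r1 near] := reach_closure_full hH0 hH g0 d0 controllable drho eps0.
exists rho1; split=> // i j; rewrite normE_cnorm ltcR.
by apply: le_lt_trans near; have := cnorm_le_mnorm (rho1 - rho) i j; rewrite !mxE.
Qed.
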